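(* Let $W$ be a finite Coxeter group with a weight function $L$ with $L(s)>0$ for all $s\in S$, satisfying properties P1–P15. Then $$\phi(T_{w_0})=\sum_{d\in\mathcal D}\vartheta(d)\,\epsilon_d\,v^{-\mathbf a(d)+\mathbf a(w_0d)}\,t_{d^*}\in J_{\mathcal A}.$$
   Context: $W$ is a finite Coxeter group with simple reflections $S$, length function $l:W\to\mathbb N$ and longest element $w_0$. A weight function is $L:W\to\mathbb N$ with $L(ww')=L(w)+L(w')$ whenever $l(ww')=l(w)+l(w')$; assume $L(s)>0$ for $s\in S$. Hecke algebra: $\mathcal A=\mathbb Z[v,v^{-1}]$ ($v$ an indeterminate). $\mathcal H$ is the $\mathcal A$-algebra with basis $\{T_x;x\in W\}$, $T_xT_y=T_{xy}$ if $l(xy)=l(x)+l(y)$, $(T_s-v^{L(s)})(T_s+v^{-L(s)})=0$ for $s\in S$. The bar involution is the ring involution of $\mathcal H$ with $v\mapsto v^{-1}$, $T_x\mapsto T_{x^{-1}}^{-1}$. $\{c_x;x\in W\}$ is the unique $\mathcal A$-basis with $\overline{c_x}=c_x$, $c_x=\sum_y p_{y,x}T_y$, $p_{x,x}=1$, $p_{y,x}\in v^{-1}\mathbb Z[v^{-1}]$ for $y\neq x$. $h\mapsto h^\dagger$ is the $\mathcal A$-algebra automorphism $T_x\mapsto(-1)^{l(x)}T_{x^{-1}}^{-1}$. Define $h_{x,y,z}\in\mathcal A$ by $c_xc_y=\sum_z h_{x,y,z}c_z$. Cells: $\le_{\mathcal L}$ is the preorder on $W$ generated by: $w\le_{\mathcal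 L}w'$ if $c_w$ appears with nonzero coefficient in $c_sc_{w'}$ for some $s\in S$; $w\le_{\mathcal R}w'$ iff $w^{-1}\le_{\mathcal L}w'^{-1}$; $\le_{\mathcal{LR}}$ is the preorder generated by $\le_{\mathcal L},\le_{\mathcal R}$. The associated equivalence relations are $\sim_{\mathcal L},\sim_{\mathcal R},\sim_{\mathcal{LR}}$, with classes the left, right, two-sided cells; $x<_{\mathcal{LR}}y$ means $x\le_{\mathcal{LR}}y$ and $x\not\sim_{\mathcal{LR}}y$. For a two-sided cell $\mathbf c$, $w_0\mathbf c=\mathbf cw_0$ is again a two-sided cell. $\mathcal H^{<\mathbf c}$ is the $\mathcal A$-span of the $c_x^\dagger$ with $x<_{\mathcal{LR}}x'$ for some $x'\in\mathbf c$. For $z\in W$, $\mathbf a(z)\in\mathbb N$ is the smallest integer with $h_{x,y,z}\in v^{\mathbf a(z)}\mathbb Z[v^{-1}]$ for all $x,y$; $\gamma_{x,y,z^{-1}}\in\mathbb Z$ is the coefficient of $v^{\mathbf a(z)}$ in $h_{x,y,z}$. Write $p_{1,z}=n_zv^{-\Delta(z)}+$ strictly smaller powers of $v$, $n_z\in\mathbb Z-\{0\}$; $\mathcal D=\{z\in W;\mathbf a(z)=\Delta(z)\}$. Properties P1–P15 (assumed to hold for $W,L$): P1: $\mathbf a(z)\le\Delta(z)$ for all $z$. P2: if $d\in\mathcal D$, $\gamma_{x,y,d}\ne0$ then $x=y^{-1}$. P3: for $y\in W$ there is a unique $d\in\mathcal D$ with $\gamma_{y^{-1},y,d}\ne0$.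 P4: $z'\le_{\mathcal{LR}}z$ implies $\mathbf a(z')\ge\mathbf a(z)$ (so $\mathbf a$ is constant on two-sided cells). P5: if $d\in\mathcal D$ and $\gamma_{y^{-1},y,d}\neq0$ then $\gamma_{y^{-1},y,d}=n_d=\pm1$. P6: $d^2=1$ for $d\in\mathcal D$. P7: $\gamma_{x,y,z}=\gamma_{y,z,x}$. P8: $\gamma_{x,y,z}\ne0$ implies $x\sim_{\mathcal L}y^{-1}$, $y\sim_{\mathcal L}z^{-1}$, $z\sim_{\mathcal L}x^{-1}$. P9, P10, P11: for $*=\mathcal L,\mathcal R,\mathcal{LR}$ respectively, $z'\le_*z$ and $\mathbf a(z')=\mathbf a(z)$ imply $z'\sim_*z$. P12: for $I\subset S$ and $y\in W_I$, $\mathbf a(y)$ computed in $W_I$ equals $\mathbf a(y)$ computed in $W$. P13: any left cell $\Gamma$ contains a unique $d\in\mathcal D$, and $\gamma_{x^{-1},x,d}\ne0$ for all $x\in\Gamma$. P14: $z\sim_{\mathcal{LR}}z^{-1}$. P15: with $h'_{x,y,z}$ obtained from $h_{x,y,z}$ by replacing $v$ by a second indeterminate $v'$, if $\mathbf a(w)=\mathbf a(y)$ then $\sum_{y'}h'_{w,x',y'}h_{x,y',y}=\sum_{y'}h_{x,w,y'}h'_{y',x',y}$ for all $x,x'$. For $x\in W$, $d_x$ is the unique element of $\mathcal D$ with $x\sim_{\mathcal L}d_x$. $J$ is the free abelian group with basis $\{t_w;w\in W\}$ and associative ring structure $t_xt_y=\sum_z\gamma_{x,y,z^{-1}}t_z$,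 with unit $\sum_{d\in\mathcal D}n_dt_d$; $J_{\mathcal A}=\mathcal A\otimes J$. $\phi:\mathcal H\to J_{\mathcal A}$ is the $\mathcal A$-algebra homomorphism with $\phi(c_x^\dagger)=\sum_{d\in\mathcal D,z\in W;d_z=d}h_{x,d,z}n_dt_z$. Definition of $u^*,\epsilon_u,\vartheta$: for each two-sided cell $\mathbf c$, with $a,a'$ the values of $\mathbf a$ on $\mathbf c$ and $w_0\mathbf c$, there is a unique permutation $u\mapsto u^*$ of $\mathbf c$ and unique signs $\epsilon_u=\pm1$ ($u\in\mathbf c$) such that $v^{a-a'}T_{w_0}c_u^\dagger=\epsilon_uc_{u^*}^\dagger\mod\mathcal H^{<\mathbf c}$ for all $u\in\mathbf c$. As $\mathbf c$ varies this defines $u^*$ and $\epsilon_u$ for all $u\in W$. For $x\in W$ set $\vartheta(x)=\gamma_{w_0d_{w_0x^{-1}},\,x,\,(x^* )^{-1}}$. *)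

(* Defs.v *)
From HB Require Import structures.
From mathcomp Require Import all_boot all_order all_algebra all_fingroup.
From mathcomp Require Import finmap.
From mathcomp.multinomials Require Import monalg.

Set Implicit Arguments.
Unset Strict Implicit.
Unset Printing Implicit Defensive.

Import Order.TTheory GRing.Theory Num.Theory.
Local Open Scope fset_scope.
Local Open Scope ring_scope.

(* Laurent polynomials are the finitely supported functions {malg R[int]};
   monalg gives a product only over monoids whose sole unit is 1, which
   excludes (int, +), hence the convolution product below. *)

Definition laurent (R : comNzRingType) : Type := {malg R[int]}.

Section LaurentRing.
Variable R : comNzRingType.
Implicit Types f g : laurent R.

HB.instance Definition _ := GRing.Zmodule.copy (laurent R) {malg R[int]}.

Definition lone : laurent R := << 1 *g 0 >>.

Definition lmul f g : laurent R :=
  \sum_(i <- msupp f) \sum_(j <- msupp g) << f@_i * g@_j *g i + j >>.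

Lemma lmulw (d1 d2 : {fset int}) f g : msupp f `<=` d1 -> msupp g `<=` d2 ->
  lmul f g = \sum_(i <- d1) \sum_(j <- d2) << f@_i * g@_j *g i + j >>.
Proof.
move=> le1 le2; rewrite /lmul (big_fset_incl _ le1) /=.
  apply/eq_bigr=> i _; apply/big_fset_incl => // k _ /mcoeff_outdom ->.
  by rewrite mulr0 monalgU0.
move=> k _ /mcoeff_outdom fk; rewrite big1 // => j _.
by rewrite fk mul0r monalgU0.
Qed.

Lemma lmulC : commutative lmul.
Proof.
move=> f g; rewrite /lmul exchange_big; apply/eq_bigr=> i _.
by apply/eq_bigr=> j _; rewrite mulrC [j + i]addrC.
Qed.

Lemma lmul0 f : lmul 0 f = 0.
Proof. by rewrite /lmul msupp0 big_seq_fset0. Qed.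

Lemma lmulDl : left_distributive lmul +%R.
Proof.
move=> f1 f2 g.
rewrite [in RHS](lmulw (fsubsetUl _ (msupp f2)) (fsubset_refl _)).
rewrite [in RHS](lmulw (fsubsetUr (msupp f1) _) (fsubset_refl _)).
rewrite (lmulw (msuppD_le _ _) (fsubset_refl _)).
rewrite -big_split /=; apply/eq_bigr=> i _.
rewrite -big_split /=; apply/eq_bigr=> j _.
by rewrite mcoeffD mulrDl monalgUD.
Qed.

Lemma lmulDr : right_distributive lmul +%R.
Proof. by move=> f g1 g2; rewrite lmulC lmulDl !(lmulC f). Qed.

Lemma lmulr0 f : lmul f 0 = 0.
Proof. by rewrite lmulC lmul0. Qed.

Lemma lmulUU (c1 c2 : R) i j :
  lmul << c1 *g i >> << c2 *g j >> = << c1 * c2 *g i + j >>.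
Proof. by rewrite (lmulw msuppU_le msuppU_le) !big_seq_fset1 !mcoeffUU. Qed.

Lemma lmul1 : left_id lone lmul.
Proof.
move=> f; rewrite (lmulw msuppU_le (fsubset_refl _)) big_seq_fset1 [RHS]monalgE.
by apply/eq_bigr=> j _; rewrite mcoeffUU mul1r add0r.
Qed.

Lemma lmul_suml (I : Type) (r : seq I) (F : I -> laurent R) g :
  lmul (\sum_(i <- r) F i) g = \sum_(i <- r) lmul (F i) g.
Proof. by apply: (big_morph (lmul^~ g)) => [f1 f2|]; rewrite ?lmulDl ?lmul0. Qed.

Lemma lmul_sumr (I : Type) (r : seq I) (F : I -> laurent R) f :
  lmul f (\sum_(i <- r) F i) = \sum_(i <- r) lmul f (F i).
Proof. by apply: (big_morph (lmul f)) => [g1 g2|]; rewrite ?lmulDr ?lmulr0. Qed.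

Lemma lmulA : associative lmul.
Proof.
move=> f g h; rewrite (monalgE f) (monalgE g) (monalgE h).
set sf := msupp f; set sg := msupp g; set sh := msupp h.
rewrite !(lmul_suml sf); apply: eq_bigr => i _.
rewrite (lmul_suml sg) !(lmul_sumr sg) (lmul_suml sg); apply: eq_bigr => j _.
by rewrite !(lmul_sumr sh); apply: eq_bigr => k _; rewrite !lmulUU mulrA addrA.
Qed.

Lemma lone_neq0 : lone != 0.
Proof. by rewrite monalgU_eq0 oner_eq0. Qed.

HB.instance Definition _ := GRing.Zmodule_isComNzRing.Build (laurent R)
  lmulA lmulC lmul1 lmulDl lone_neq0.

End LaurentRing.

Notation Zv := (laurent int).

Definition vpow (R : comNzRingType) (k : int) : laurent R := << 1 *g k >>.
Notation "''v^' k" := (vpow int k) (at level 8, k at level 2, format "''v^' k").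

(* f \in v^n Z[v^-1] *)
Definition in_vZ (n : int) (f : Zv) : bool := all (fun k => k <= n) (msupp f).

(* Largest exponent of f, with value 0 at f = 0 *)
Definition topdeg (f : Zv) : int := last 0 (sort <=%R (msupp f)).

(* The substitution v |-> v^-1 *)
Definition vbar (f : Zv) : Zv := mmap intr (fun k => vpow int (- k)) f.

(* Z[v^+-1, v'^+-1] is taken as (Z[v^+-1])[v'^+-1]. *)
Definition in_v (f : Zv) : laurent Zv := << f *g 0 >>.
Definition in_v' (f : Zv) : laurent Zv := mmap intr (vpow Zv) f.

Record fbasis (R : nzRingType) (V : lmodType R) (I : finType) := FBasis {
  bvec :> I -> V;
  bcoord : I -> V -> R;
  bvecE : forall x : V, x = \sum_i bcoord i x *: bvec i;
  bcoordE : forall (f : I -> R) i, bcoord i (\sum_j f j *: bvec j) = f i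
}.

Definition inverse_of (R : nzRingType) (x y : R) : Prop := x * y = 1 /\ y * x = 1.

Section Coxeter.
Local Open Scope group_scope.
Variables (W : finGroupType) (S : {set W}).

(* (W, S) is presented by the relations (s t)^m(s,t) = 1, with m(s,t) the order
   of s t in W; the case s = t gives s^2 = 1. *)
Definition coxeter_system : Prop :=
  [/\ <<S>> = [set: W],
      {in S, forall s, #[s] = 2%N}
    & forall (X : groupType) (f : W -> X),
        {in S &, forall s t, (f s * f t) ^+ #[s * t] = 1} ->
        exists g : {multiplicative W -> X}, {in S, g =1 f}].

(* S ^+ n is the set of products of n elements of S; the bound #|W| is harmless
   because the prefixes of a reduced word are pairwise distinct. *)
Definition len (w : W) : nat := find (fun n => w \in S ^+ n) (iota 0 #|W|).

Definition longest : W := [arg max_(w > (1 : W)) len w].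

Definition weight_function (L : W -> nat) : Prop :=
  forall w w', len (w * w') = (len w + len w')%N ->
    L (w * w') = (L w + L w')%N.

End Coxeter.

(* The Hecke algebra of (W, S, L) with its bar involution, its basis c_x and the
   automorphism h |-> h^dagger, each given by the properties that determine it. *)
Record hecke (W : finGroupType) (S : {set W}) (L : W -> nat) := Hecke {
  hecke_alg :> algType Zv;
  Tbasis : fbasis hecke_alg W;
  Tbasis_mul : forall x y, len S (x * y)%g = (len S x + len S y)%N ->
    Tbasis x * Tbasis y = Tbasis (x * y)%g;
  Tbasis_quad : forall s, s \in S ->
    (Tbasis s - ('v^((L s)%:Z))%:A) * (Tbasis s + ('v^(- (L s)%:Z))%:A) = 0;
  hbar : {rmorphism hecke_alg -> hecke_alg};
  hbarK : involutive hbar;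
  hbarZ : forall (f : Zv) h, hbar (f *: h) = vbar f *: hbar h;
  hbar_Tbasis : forall x, inverse_of (hbar (Tbasis x)) (Tbasis x^-1%g);
  cbasis : fbasis hecke_alg W;
  cbasis_bar : forall x, hbar (cbasis x) = cbasis x;
  cbasis_diag : forall x, bcoord Tbasis x (cbasis x) = 1;
  cbasis_offdiag : forall x y, y != x ->
    in_vZ (-1) (bcoord Tbasis y (cbasis x));
  dag : {lrmorphism hecke_alg -> hecke_alg};
  dag_bij : bijective dag;
  dag_Tbasis : forall x,
    inverse_of ((-1) ^+ len S x * dag (Tbasis x)) (Tbasis x^-1%g)
}.

Section Cells.
Variables (W : finGroupType) (S : {set W}) (L : W -> nat) (H : hecke S L).
Implicit Types x y z w d u : W.

Definition hcoef x y z : Zv := bcoord (cbasis H) z (cbasis H x * cbasis H y).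
Definition pcoef y x : Zv := bcoord (Tbasis H) y (cbasis H x).

Definition leL : rel W :=
  connect (fun w w' => [exists s in S, hcoef s w' w != 0]).
Definition leR : rel W := fun w w' => leL w^-1%g w'^-1%g.
Definition leLR : rel W := connect (fun w w' => leL w w' || leR w w').
Definition eqL : rel W := fun x y => leL x y && leL y x.
Definition eqR : rel W := fun x y => leR x y && leR y x.
Definition eqLR : rel W := fun x y => leLR x y && leLR y x.
Definition ltLR : rel W := fun x y => leLR x y && ~~ eqLR x y.

Definition left_cells : {set {set W}} := equivalence_partition eqL [set: W].
Definition twosided_cells : {set {set W}} := equivalence_partition eqLR [set: W].

Lemma in_vZ_bound (f : Zv) : exists n : nat, in_vZ n%:Z f.
Proof.
exists (\max_(k <- msupp f) `|k|%N); apply/allP => k kf.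
by apply: (le_trans (lez_abs k)); rewrite lez_nat;
  apply: (@leq_bigmax_seq int _ xpredT absz).
Qed.

Lemma afun_ex z : exists n : nat, [forall x, forall y, in_vZ n%:Z (hcoef x y z)].
Proof.
have ex x y : {n : nat | in_vZ n%:Z (hcoef x y z)}.
  exists (ex_minn (in_vZ_bound (hcoef x y z))).
  by case: ex_minnP.
exists (\max_x \max_y sval (ex x y)); apply/forallP=> x; apply/forallP=> y.
apply/allP => k kf; have /allP/(_ k kf) kn := svalP (ex x y).
apply: (le_trans kn); rewrite lez_nat.
have le1 := @leq_bigmax W (fun x => \max_y sval (ex x y)) x.
exact: leq_trans (@leq_bigmax W (fun y => sval (ex x y)) y) le1.
Qed.

(* The minimum over the integers is attained in nat since h_{1,z,z} = 1. *)
Definition afun z : nat := ex_minn (afun_ex z).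

(* gamma x y (z^-1) is the coefficient of v^a(z) in h_{x,y,z}. *)
Definition gamma x y z : int := (hcoef x y z^-1%g)@_((afun z^-1%g)%:Z).

Definition Delta z : int := - topdeg (pcoef 1%g z).
Definition ncoef z : int := (pcoef 1%g z)@_(topdeg (pcoef 1%g z)).
Definition Dset : {set W} := [set z | (afun z)%:Z == Delta z].

End Cells.

Record propertiesP (W : finGroupType) (S : {set W}) (L : W -> nat)
    (H : hecke S L) : Prop := PropertiesP {
  P1 : forall z, (afun H z)%:Z <= Delta H z;
  P2 : forall d x y, d \in Dset H -> gamma H x y d != 0 -> x = y^-1%g;
  P3 : forall y, exists! d, d \in Dset H /\ gamma H y^-1%g y d != 0;
  P4 : forall z' z, leLR H z' z -> (afun H z <= afun H z')%N;
  P5 : forall d y, d \in Dset H -> gamma H y^-1%g y d != 0 ->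
    gamma H y^-1%g y d = ncoef H d /\ (ncoef H d = 1 \/ ncoef H d = -1);
  P6 : forall d, d \in Dset H -> (d ^+ 2 = 1)%g;
  P7 : forall x y z, gamma H x y z = gamma H y z x;
  P8 : forall x y z, gamma H x y z != 0 ->
    [/\ eqL H x y^-1%g, eqL H y z^-1%g & eqL H z x^-1%g];
  P9 : forall z' z, leL H z' z -> afun H z' = afun H z -> eqL H z' z;
  P10 : forall z' z, leR H z' z -> afun H z' = afun H z -> eqR H z' z;
  P11 : forall z' z, leLR H z' z -> afun H z' = afun H z -> eqLR H z' z;
  (* HI is the Hecke algebra of the parabolic subgroup W_I = <<I>>, which as a
     type is [subg <<I>>], with inclusion sgval into W. *)
  P12 : forall (I : {set W}), I \subset S ->
    forall (HI : @hecke (subg_of <<I>>%G) (sgval @^-1: I) (L \o sgval))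
      (y : subg_of <<I>>%G),
    afun HI y = afun H (sgval y);
  P13 : forall G, G \in left_cells H ->
    exists d, unique (fun d => d \in Dset H /\ d \in G) d /\
      {in G, forall x, gamma H x^-1%g x d != 0};
  P14 : forall z, eqLR H z z^-1%g;
  P15 : forall x x' w y, afun H w = afun H y ->
    \sum_y' in_v' (hcoef H w x' y') * in_v (hcoef H x y' y) =
    \sum_y' in_v (hcoef H x w y') * in_v' (hcoef H y' x' y)
}.

Section Asymptotic.
Variables (W : finGroupType) (S : {set W}) (L : W -> nat) (H : hecke S L).

(* d_x; the default value x is never used when P13 holds. *)
Definition dL (x : W) : W := odflt x [pick d in Dset H | eqL H x d].

(* R \otimes J: the R-algebra with basis t_w and the structure constants of J;
   J itself is the case R = int. *)
Record asymptotic (R : comNzRingType) := Asymptotic {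
  asym_alg :> algType R;
  tbasis : fbasis asym_alg W;
  tbasis_mul : forall x y,
    tbasis x * tbasis y = \sum_z (gamma H x y z^-1%g)%:~R *: tbasis z;
  tbasis_one : 1 = \sum_(d in Dset H) (ncoef H d)%:~R *: tbasis d
}.

Definition is_phi (J : asymptotic Zv) (phi : {lrmorphism H -> J}) : Prop :=
  forall x, phi (dag H (cbasis H x)) =
    \sum_(d in Dset H) \sum_(z | dL z == d)
      (hcoef H x d z * (ncoef H d)%:~R) *: tbasis J z.

(* h \in H^{<c} *)
Definition in_lower (c : {set W}) (h : H) : Prop :=
  exists f : W -> Zv,
    h = \sum_(x | [exists x' in c, ltLR H x x']) f x *: dag H (cbasis H x).

Local Notation w0 := (longest S).

(* On a two-sided cell c, a and a' are the constant values of the a-function on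
   c and w0 c, so they are afun u and afun (w0 u) for any u in c. *)
Definition star_eps (star : W -> W) (eps : W -> int) : Prop :=
  forall c, c \in twosided_cells H ->
    [/\ {in c &, injective star}, star @: c = c,
        {in c, forall u, eps u = 1 \/ eps u = -1}
      & {in c, forall u,
          in_lower c
            ('v^((afun H u)%:Z - (afun H (w0 * u)%g)%:Z)
               *: (Tbasis H w0 * dag H (cbasis H u))
             - (eps u)%:~R *: dag H (cbasis H (star u)))}].

Definition theta (star : W -> W) (x : W) : int :=
  gamma H (w0 * dL (w0 * x^-1))%g x (star x)^-1%g.

End Asymptotic.

(* Main.v *)
Require Import Defs.
From mathcomp Require Import all_boot all_order all_algebra all_fingroup.
From mathcomp Require Import finmap.
From mathcomp.multinomials Require Import monalg.
From mathcomp Require Import zify.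

(** The homomorphism phi makes J a left module over the Hecke algebra. The
    leading coefficients in v' of property P15 show that h in this module acts
    on t_u as h acts on the class of c_u^dag modulo terms of larger a-value
    (phi_dag_mul). The definition of u* and eps_u therefore says that
    phi(T_{w0}) t_u = eps_u v^(-a(u) + a(w0 u)) t_{u*} (phi_Tw0_mul).
    Applying this to the unit of J, the sum of the n_d t_d over D, gives
    phi(T_{w0}) = sum over d in D of n_d eps_d v^(-a(d) + a(w0 d)) t_{d*},
    and it remains to see that theta(d) = n_d for d in D (theta_D).

    That equality holds as soon as d* lies in the left cell of d and w0 d* lies
    in D (star_D). Indeed w0 d* is then in the left cell of w0 d, hence is the
    element of D in that cell, and theta(d) = gamma_{d*,d,d*^-1} = n_d.
    Membership in D is a statement about the leading coefficient of p_{1,z}. The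
    polynomials p_{1,z^-1 w0} are, up to sign, the coordinates of T_{w0} in the
    c-basis (bcoord_C_Tw0), by Kazhdan-Lusztig inversion: the elements
    c_w^dag T_{w0} form, up to sign, the basis dual to the c-basis for the trace
    form (tau_C_dualC). Since the inverse of T_{w0} is both its bar conjugate and,
    up to sign, its image under dagger, the action of T_{w0} on c_d^dag gives an
    identity between powers of v and these polynomials, whose extreme
    coefficients prove star_D.

    The same duality shows that multiplication by w0 reverses the preorders
    (hcoef_w0): left multiplication on the dual basis is transposed to right
    multiplication on the c-basis. Conjugation by T_{w0} and the
    anti-automorphism T_x |-> T_{x^-1} both permute the c-basis, which transfers
    this to the other side. The facts needed about lengths rest on the exchange
    condition, obtained by comparing the two bracketings of T_s T_u T_t
    (fold_exchange). *)

Set Implicit Arguments.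
Unset Strict Implicit.
Unset Printing Implicit Defensive.

Import Order.TTheory GRing.Theory Num.Theory.
Local Open Scope ring_scope.

(** * Coefficients of Laurent polynomials *)

Section LaurentCoef.
Variable R : comNzRingType.
Implicit Types f g : laurent R.

Lemma mcoeff_sum (I : Type) (r : seq I) (P : pred I) (F : I -> laurent R) k :
  (\sum_(i <- r | P i) F i)@_k = \sum_(i <- r | P i) (F i)@_k.
Proof. exact: (raddf_sum (mcoeff k)). Qed.

Lemma mcoeffM_laurent f g k : (f * g)@_k = \sum_(i <- msupp f) f@_i * g@_(k - i).
Proof.
rewrite [f * g]/(lmul f g) /lmul mcoeff_sum; apply: eq_bigr => i _ /=.
rewrite mcoeff_sum /=.
under eq_bigr do rewrite mcoeffU.
case: (boolP (k - i \in msupp g)) => ki.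
  rewrite (big_fsetD1 (k - i)) //= subrKC eqxx mulr1n big1_seq ?addr0 // => j.
  rewrite /= in_fsetD1 => /andP[jki _]; case: eqP => // ijk.
  by case/eqP: jki; rewrite -ijk addrC addKr.
rewrite (mcoeff_outdom ki) mulr0 big_seq big1 // => j jg.
by case: eqP => // ijk; case/negP: ki; rewrite -ijk addrC addKr.
Qed.

Lemma mcoeffM_vpow f k j : (f * vpow R j)@_k = f@_(k - j).
Proof.
rewrite mulrC mcoeffM_laurent /vpow msuppU oner_eq0 big_seq_fset1 mcoeffUU.
by rewrite mul1r.
Qed.

Lemma mcoeff_vpow j k : (vpow R j)@_k = (j == k)%:R.
Proof. exact: mcoeffU. Qed.

Lemma mcoeff_one k : (1 : laurent R)@_k = (0 == k)%:R.
Proof. exact: mcoeffU. Qed.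

Lemma mcoeff_intr (n : int) k : (n%:~R : laurent R)@_k = n%:~R *+ (0 == k).
Proof. by rewrite (raddfMz (mcoeff k)) /= mcoeff_one; case: (0 == k); rewrite ?mul0rz. Qed.

Lemma vpowD i j : vpow R (i + j) = vpow R i * vpow R j.
Proof. by rewrite [RHS]lmulUU mulr1. Qed.

Lemma vpow0 : vpow R 0 = 1. Proof. by []. Qed.

End LaurentCoef.

Section IntegerLaurent.
Implicit Types f g : Zv.

Lemma in_vZP n f : reflect (forall k, n < k -> f@_k = 0) (in_vZ n f).
Proof.
apply: (iffP allP) => fn k.
  move=> nk; apply: mcoeff_outdom; apply: contraL nk => /fn.
  by rewrite leNgt.
by rewrite leNgt -mcoeff_neq0; apply: contraNN => /fn ->.
Qed.

Lemma in_vZ_trans m n f : m <= n -> in_vZ m f -> in_vZ n f.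
Proof. by move=> mn /in_vZP fm; apply/in_vZP=> k /(le_lt_trans mn)/fm. Qed.

Lemma in_vZM m n f g : in_vZ m f -> in_vZ n g -> in_vZ (m + n) (f * g).
Proof.
move=> /in_vZP fm /in_vZP gn; apply/in_vZP => k mnk.
rewrite mcoeffM_laurent big1_seq // => i _.
case: (ltP m i) => [/fm ->|im]; first by rewrite mul0r.
by rewrite gn ?mulr0 // ltrBrDr (le_lt_trans _ mnk) // addrC lerD2r.
Qed.

Lemma mcoeffM_top m n f g : in_vZ m f -> in_vZ n g ->
  (f * g)@_(m + n) = f@_m * g@_n.
Proof.
move=> /in_vZP fm /in_vZP gn; rewrite mcoeffM_laurent.
have z i : i != m -> f@_i * g@_(m + n - i) = 0.
  case: ltgtP => // [im|/fm ->]; last by rewrite mul0r.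
  by rewrite gn ?mulr0 // ltrBrDr addrC ltrD2r.
case: (boolP (m \in msupp f)) => mf.
  rewrite (big_fsetD1 m) //= [X in _ + X]big1_seq ?addr0 ?[m + n]addrC ?addrK //.
  by move=> i /=; rewrite in_fsetD1 => /andP[im _]; rewrite addrC z.
rewrite (mcoeff_outdom mf) mul0r big1_seq // => i /= If.
by apply: z; apply: contraNneq mf => <-.
Qed.

Lemma mcoeff_vbar f k : (vbar f)@_k = f@_(- k).
Proof.
rewrite /vbar mmapE mcoeff_sum /=.
have E (i : int) : ((f@_i)%:~R * vpow int (- i) : Zv)@_k = f@_i * (i == - k)%:R.
  rewrite mcoeffM_vpow mcoeff_intr intz opprK mulr_natr.
  by congr (_ *+ nat_of_bool _); rewrite eq_sym addrC addr_eq0.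
under eq_bigr do rewrite E.
case: (boolP (- k \in msupp f)) => kf.
  rewrite (big_fsetD1 (- k)) //= eqxx mulr1 big1_seq ?addr0 // => i.
  by rewrite /= in_fsetD1 => /andP[/negPf-> _]; rewrite mulr0.
rewrite (mcoeff_outdom kf) big1_seq // => i /= If.
by case: eqP => [ik|]; rewrite ?mulr0 //; case/negP: kf; rewrite -ik.
Qed.

End IntegerLaurent.

(** * Coordinates in a finite basis *)

Section FiniteBasis.
Variables (R : nzRingType) (V : lmodType R) (I : finType) (b : fbasis V I).

Lemma bcoordD i x y : bcoord b i (x + y) = bcoord b i x + bcoord b i y.
Proof.
rewrite {1}(bvecE b x) {1}(bvecE b y) -big_split /=.
by under eq_bigr do rewrite -scalerDl; rewrite bcoordE.
Qed.

Lemma bcoordZ i a x : bcoord b i (a *: x) = a * bcoord b i x.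
Proof.
rewrite {1}(bvecE b x) scaler_sumr.
by under eq_bigr do rewrite scalerA; rewrite bcoordE.
Qed.

Lemma bcoord0 i : bcoord b i 0 = 0.
Proof. by rewrite -(scale0r 0) bcoordZ mul0r. Qed.

Lemma bcoord_sum i (J : Type) (r : seq J) P (F : J -> V) :
  bcoord b i (\sum_(j <- r | P j) F j) = \sum_(j <- r | P j) bcoord b i (F j).
Proof. exact: (big_morph (bcoord b i) (bcoordD i) (bcoord0 i)). Qed.

Lemma bcoord_bvec i j : bcoord b i (b j) = (i == j)%:R.
Proof.
rewrite -[b j](_ : \sum_k (k == j)%:R *: b k = b j) ?bcoordE //.
rewrite (bigD1 j) //= eqxx scale1r big1 ?addr0 // => k /negPf ->.
by rewrite scale0r.
Qed.

Lemma bcoord_inj x y : (forall i, bcoord b i x = bcoord b i y) -> x = y.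
Proof. by move=> e; rewrite (bvecE b x) (bvecE b y); apply: eq_bigr => i _; rewrite e. Qed.

End FiniteBasis.

(** * The length function *)

Section Length.
Local Open Scope group_scope.
Variables (W : finGroupType) (S : {set W}).
Hypothesis W_cox : coxeter_system S.
Local Notation l := (len S).
Implicit Types x y z w s t : W.

Lemma expression_exists w : exists n, w \in S ^+ n.
Proof.
have [Sgen _ _] := W_cox.
have /gen_prodgP[n [c cS ->]] : w \in <<S>> by rewrite Sgen inE.
exists n; elim: n c cS => [|n IHn] c cS; first by rewrite big_ord0 expg0 inE.
by rewrite big_ord_recr expgSr /= mem_mulg // IHn.
Qed.

(** The prefixes of a shortest expression with n letters realize every length up
    to n, hence are n + 1 distinct elements of W. *)
Lemma minlen_bound w n : w \in S ^+ n -> (forall m, w \in S ^+ m -> n <= m)%N ->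
  (n < #|W|)%N.
Proof.
move=> wn nmin.
have ex k : (k <= n)%N -> exists w', w' \in S ^+ k /\ forall m, w' \in S ^+ m -> (k <= m)%N.
  move=> kn; have: w \in S ^+ k * S ^+ (n - k) by rewrite -expgD subnKC.
  case/mulsgP=> x y xk yk wxy; exists x; split=> // m xm.
  have /nmin: w \in S ^+ (m + (n - k)) by rewrite expgD wxy mem_mulg.
  lia.
have exo (k : 'I_n.+1) : exists w', (w' \in S ^+ k) && [forall m : 'I_k, w' \notin S ^+ m].
  have [|w' [w'k w'min]] := ex k; first by rewrite -ltnS.
  exists w'; rewrite w'k; apply/forallP=> m.
  by apply/negP => /w'min; rewrite leqNgt ltn_ord.
pose f (k : 'I_n.+1) := xchoose (exo k).
have fP (k m : 'I_n.+1) : f k = f m -> (k <= m)%N.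
  move=> fkm; rewrite leqNgt; apply/negP=> mk.
  have /andP[fm _] := xchooseP (exo m); have /andP[_ /forallP fk] := xchooseP (exo k).
  by have /negP := fk (Ordinal mk); apply; rewrite -/(f k) fkm.
have finj : injective f.
  move=> k m fkm; apply: val_inj; apply/eqP; rewrite eqn_leq.
  by rewrite (fP k m) // (fP m k).
by have := leq_card f finj; rewrite card_ord.
Qed.

Lemma lenP w : (w \in S ^+ l w) * (forall m, w \in S ^+ m -> (l w <= m)%N).
Proof.
case: (ex_minnP (expression_exists w)) => n wn nmin.
have nW := minlen_bound wn nmin.
suff -> : l w = n by [].
rewrite /len; have hasn : has (fun n => w \in S ^+ n) (iota 0 #|W|).
  by apply/hasP; exists n; rewrite ?mem_iota.
have fW := hasn; rewrite has_find size_iota in fW.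
apply/eqP; rewrite eqn_leq; apply/andP; split; last first.
  by apply: nmin; have := nth_find 0%N hasn; rewrite nth_iota ?add0n.
rewrite leqNgt; apply/negP => nf; have := before_find 0%N nf.
by rewrite nth_iota ?add0n ?wn.
Qed.

Lemma len_le w n : w \in S ^+ n -> (l w <= n)%N.
Proof. exact: (lenP w).2. Qed.

Lemma len1 : l 1 = 0%N.
Proof. by apply/eqP; rewrite -leqn0 len_le // expg0 inE. Qed.

Lemma len_eq0 w : l w = 0%N -> w = 1.
Proof. by move=> lw; have := (lenP w).1; rewrite lw expg0 inE => /eqP. Qed.

Lemma lenM x y : (l (x * y) <= l x + l y)%N.
Proof. by apply: len_le; rewrite expgD mem_mulg ?(lenP _).1. Qed.

Lemma gen_sqr s : s \in S -> s * s = 1.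
Proof.
have [_ S2 _] := W_cox => /S2 s2.
by have := expg_order s; rewrite s2 expgS expg1.
Qed.

Lemma gen_inv s : s \in S -> s^-1 = s.
Proof. by move=> /gen_sqr/eqP; rewrite -eq_invg_mul => /eqP. Qed.

Lemma lenV x : l x^-1 = l x.
Proof.
suff le y : (l y^-1 <= l y)%N.
  by apply/eqP; rewrite eqn_leq le -{1}[x]invgK le.
apply: len_le; move: (lenP y).1; move: (l y) => n.
elim: n y => [|n IHn] y; first by rewrite expg0 !inE => /eqP->; rewrite invg1.
rewrite expgS => /mulsgP[s z sS zn ->]; rewrite invMg -expgS expgSr mem_mulg ?IHn //.
by rewrite gen_inv.
Qed.

Lemma len_descent w : w != 1 -> exists2 s, s \in S & l w = (l (s * w)).+1.
Proof.
move=> w1; have := (lenP w).1; case lw: (l w) => [|n].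
  by move/len_eq0: lw w1 => ->; rewrite eqxx.
rewrite expgS => /mulsgP[s z sS zn wE]; exists s => //.
have zE : s * w = z by rewrite wE mulgA gen_sqr // mul1g.
rewrite zE; apply/eqP; rewrite eqSS eqn_leq (len_le zn) andbT -ltnS.
rewrite -lw wE (leq_trans (lenM _ _)) // -add1n leq_add2r.
by apply: len_le; rewrite expg1.
Qed.

(** The defining relations have even length, so the sign character exists; it
    takes different values at s w and w. *)
Lemma len_parity s w : s \in S -> l (s * w) != l w.
Proof.
move=> sS; have [_ _ univ] := W_cox.
pose t := tperm true false.
have tt : t * t = 1 by rewrite tperm2.
have [|g gS] := univ {perm bool} (fun _ => t).
  by move=> ? ? _ _; rewrite tt expg1n.
have g1 : g 1 = 1 by apply: (mulgI (g 1)); rewrite -gmulfM !mulg1.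
have gl w' : g w' = t ^+ l w'.
  move: (lenP w').1; move: (l w') => n.
  elim: n w' => [|n IHn] w'; first by rewrite expg0 !inE => /eqP->.
  by rewrite !expgS => /mulsgP[u z uS zn ->]; rewrite gmulfM gS // (IHn z).
apply: contraTneq isT => lsw.
have : g (s * w) = g w by rewrite !gl lsw.
rewrite gmulfM gS // => /(canRL (mulgK _)); rewrite mulgV => t1.
by have := tpermL true false; rewrite -/t t1 perm1.
Qed.

Lemma len_gen s : s \in S -> l s = 1%N.
Proof.
move=> sS; have := len_parity 1 sS; rewrite mulg1 len1.
have : (l s <= 1)%N by apply: len_le; rewrite expg1.
by case: (l s) => [|[]].
Qed.

Lemma len_mulS s w : s \in S -> l (s * w) = (l w).+1 \/ l w = (l (s * w)).+1.
Proof.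
move=> sS; have := len_parity w sS; have := lenM s w; have := lenM s (s * w).
rewrite mulgA (gen_sqr sS) mul1g (len_gen sS); lia.
Qed.

End Length.

(** * Multiplication in the basis T, and the longest element *)

Section StandardBasis.
Variables (W : finGroupType) (S : {set W}) (L : W -> nat).
Hypothesis W_cox : coxeter_system S.
Hypothesis L_pos : forall s, s \in S -> (0 < L s)%N.
Variable H : hecke S L.
Local Notation l := (len S).
Local Notation T := (Tbasis H).
Implicit Types x y z w s t u : W.

Definition qpar s : Zv := 'v^((L s)%:Z) - 'v^(- (L s)%:Z).
Local Notation q := qpar.

Lemma qpar_neq0 s : s \in S -> q s != 0.
Proof.
move=> /L_pos Ls; apply/eqP => /(congr1 (mcoeff (L s)%:Z)).
rewrite mcoeffB mcoeff0 !mcoeff_vpow eqxx; case: eqP => //; lia.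
Qed.

Lemma T_1 : T 1%g = 1.
Proof.
have T1x x : T 1%g * T x = T x by rewrite Tbasis_mul mul1g // (len1 W_cox).
rewrite -[T 1%g]mulr1 (bvecE T 1) mulr_sumr; apply: eq_bigr => x _.
by rewrite -scalerAr T1x.
Qed.

Lemma T_sqr s : s \in S -> T s * T s = 1 + q s *: T s.
Proof.
move=> sS; have := Tbasis_quad H sS.
rewrite mulrDr !mulrBl !mulr_algr !mulr_algl scalerA -vpowD addNr vpow0 scale1r.
move/eqP; rewrite addrC addr_eq0 => /eqP e.
rewrite -[T s * T s](subrK ('v^((L s)%:Z) *: T s)) -[T s * T s - _]opprK -e.
by rewrite opprB scalerBl -addrA [- _ + _]addrC.
Qed.

Lemma T_up s w : s \in S -> l (s * w)%g = (l w).+1 -> T s * T w = T (s * w)%g.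
Proof. by move=> sS lsw; rewrite Tbasis_mul // lsw (len_gen W_cox sS). Qed.

Lemma T_down s w : s \in S -> l w = (l (s * w)%g).+1 ->
  T s * T w = T (s * w)%g + q s *: T w.
Proof.
move=> sS lw; have ssw : (s * (s * w))%g = w by rewrite mulgA (gen_sqr W_cox) ?mul1g.
have Tw : T s * T (s * w)%g = T w by rewrite T_up ?ssw.
by rewrite -{1}Tw mulrA T_sqr // mulrDl mul1r -scalerAl Tw.
Qed.

Lemma T_up_r s w : s \in S -> l (w * s)%g = (l w).+1 -> T w * T s = T (w * s)%g.
Proof. by move=> sS lws; rewrite Tbasis_mul // lws (len_gen W_cox sS) addn1. Qed.

Lemma T_down_r s w : s \in S -> l w = (l (w * s)%g).+1 ->
  T w * T s = T (w * s)%g + q s *: T w.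
Proof.
move=> sS lw; have wss : (w * s * s)%g = w by rewrite -mulgA (gen_sqr W_cox) ?mulg1.
have Tw : T (w * s)%g * T s = T w by rewrite T_up_r ?wss.
by rewrite -{1}Tw -mulrA T_sqr // mulrDr mulr1 -scalerAr Tw.
Qed.

(** The two bracketings of T_s T_u T_t differ by multiples of T_{su} and of
    T_{ut}, so the associativity of the Hecke algebra yields this form of the
    exchange condition. *)
Lemma fold_exchange s t u : s \in S -> t \in S ->
  l (s * u)%g = (l u).+1 -> l (u * t)%g = (l u).+1 ->
  l (u * t)%g = (l (s * u * t)%g).+1 -> (s * u = u * t)%g.
Proof.
move=> sS tS lsu lut lsut.
have e1 : T s * T u * T t = T (s * u * t)%g + q t *: T (s * u)%g.
  by rewrite T_up // T_down_r // lsu; congr _.+1; lia.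
have e2 : T s * T u * T t = T (s * u * t)%g + q s *: T (u * t)%g.
  by rewrite -mulrA T_up_r // T_down ?mulgA.
move: e2; rewrite e1 => /addrI /(congr1 (bcoord T (s * u)%g)).
rewrite !bcoordZ !bcoord_bvec eqxx mulr1; case: eqP => // _.
by rewrite mulr0 => /eqP qt0; have := qpar_neq0 tS; rewrite qt0.
Qed.

(** Read a reduced expression of y from left to right, as a continuation of one
    of a: at the letter where left multiplication by s stops increasing the
    length, the previous lemma moves s to the right of the prefix, where it
    cancels that letter. *)
Lemma exchange_len y a s : s \in S -> l (s * a)%g = (l a).+1 ->
  l (a * y)%g = (l a + l y)%N -> (l (s * a * y) < l (a * y))%g%N ->
  (l (a^-1 * s * a * y)%g < l y)%N.
Proof.
move=> sS; have [n le_yn] := ubnP (l y); elim: n => // n IHn in y a le_yn *.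
move=> lsa lay; have [->|y1] := eqVneq y 1%g.
  by rewrite !mulg1 lsa ltnNge leqnSn.
have [t tS ly] := len_descent W_cox y1; set y' := (t * y)%g in ly.
have yE : (y = t * y')%g by rewrite /y' mulgA (gen_sqr W_cox) ?mul1g.
clearbody y'.
have lat : l (a * t)%g = (l a).+1.
  have := lenM W_cox a t; have := lenM W_cox (a * t) y'.
  rewrite -mulgA -yE lay (len_gen W_cox tS); lia.
move=> lsay; have [lsat|lsat] := len_mulS W_cox (a * t) sS; last first.
  have e : (s * a = a * t)%g by apply: fold_exchange => //; rewrite -mulgA.
  rewrite -!mulgA [(s * _)%g]mulgA e yE -!mulgA.
  rewrite [(t * (t * _))%g]mulgA (gen_sqr W_cox) // mul1g mulKg.
  by rewrite -yE ly.
have aty : (a * t * y' = a * y)%g by rewrite yE mulgA.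
have IH : (l ((a * t)^-1 * s * (a * t) * y')%g < l y')%N.
  by apply: IHn => //; [lia | rewrite aty; lia | rewrite -[(s * _ * y')%g]mulgA aty mulgA].
have e : (a^-1 * s * a * y = t * ((a * t)^-1 * s * (a * t) * y'))%g.
  rewrite invMg (gen_inv W_cox tS) -!mulgA [(t * (t * _))%g]mulgA.
  by rewrite (gen_sqr W_cox tS) mul1g -yE.
have := lenM W_cox t ((a * t)^-1 * s * (a * t) * y').
rewrite -e (len_gen W_cox tS); lia.
Qed.

Local Notation w0 := (longest S).

Lemma longest_max w : (l w <= l w0)%N.
Proof. by rewrite /longest; case: arg_maxnP => //= i _ /(_ w isT). Qed.

(** If x = x' s is longer than x' and w0 = x'^-1 (x' w0) has additive lengths,
    then s w0 is shorter than w0, and the exchange must remove a letter of x' w0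
    because s x'^-1 is longer than x'^-1. *)
Lemma len_longest_mul x : (l (x * w0)%g + l x = l w0)%N.
Proof.
suff le_x : (l (x * w0)%g + l x <= l w0)%N.
  apply/eqP; rewrite eqn_leq le_x /= addnC.
  have := lenM W_cox x^-1 (x * w0); rewrite mulKg (lenV W_cox) //.
have [n le_xn] := ubnP (l x); elim: n => // n IHn in x le_xn *.
have [->|x1] := eqVneq x 1%g; first by rewrite mul1g (len1 W_cox) addn0.
have [|s sS lx] := len_descent W_cox (w := x^-1%g); first by rewrite invg_eq1.
rewrite (lenV W_cox) // -(lenV W_cox (s * _)) invMg invgK (gen_inv W_cox) // in lx.
set x' := (x * s)%g in lx; have xE : (x = x' * s)%g by rewrite -mulgA (gen_sqr W_cox) ?mulg1.
clearbody x'.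
have /IHn IH : (l x' < n)%N by lia.
have lb : l (x'^-1 * (x' * w0))%g = (l x'^-1 + l (x' * w0))%N.
  have := lenM W_cox x'^-1 (x' * w0); rewrite mulKg (lenV W_cox) //; lia.
have lsx : l (s * x'^-1)%g = (l x'^-1)%g.+1.
  by rewrite -{1}(gen_inv W_cox sS) -invMg -xE !(lenV W_cox).
have := exchange_len sS lsx lb; rewrite mulKg invgK -!mulgA mulKg.
have [e|lsw0] := len_mulS W_cox w0 sS.
  by have := longest_max (s * w0); rewrite e ltnn.
rewrite lsw0 ltnS leqnn => /(_ isT); rewrite [(x' * (s * _))%g]mulgA -xE => lt_x.
by rewrite lx addnS -lsw0 -addSn (leq_trans _ IH) ?leq_add2r.
Qed.

Lemma longestK : (w0 * w0 = 1)%g.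
Proof.
apply: (len_eq0 W_cox); have := len_longest_mul w0; lia.
Qed.

Lemma longestV : (w0^-1 = w0)%g.
Proof. by apply/eqP; rewrite eq_invg_mul longestK. Qed.

Lemma len_mul_longest x : (l (w0 * x)%g + l x = l w0)%N.
Proof.
rewrite -(len_longest_mul x^-1) (lenV W_cox) -(lenV W_cox (w0 * x)).
by rewrite invMg longestV.
Qed.

End StandardBasis.

(** * The bar involution on Laurent polynomials *)

Lemma vbarD f g : vbar (f + g) = vbar f + vbar g.
Proof. by apply/malgP=> k; rewrite mcoeffD !mcoeff_vbar mcoeffD. Qed.

Lemma vbar_nat (n : nat) : vbar n%:R = n%:R.
Proof.
apply/malgP=> k; rewrite mcoeff_vbar pmulrn !mcoeff_intr.
by rewrite [0 == - k]eq_sym oppr_eq0 eq_sym.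
Qed.

Lemma vbar_vpow k : vbar 'v^k = 'v^(- k).
Proof. by apply/malgP=> j; rewrite mcoeff_vbar !mcoeff_vpow -eqr_oppLR. Qed.

Lemma vbar_fix_neg f : vbar f = f -> in_vZ (-1) f -> f = 0.
Proof.
move=> ff /in_vZP fn; apply/malgP=> k; rewrite mcoeff0.
have [k0|k0] := leP 0 k; first by apply: fn; lia.
by rewrite -ff mcoeff_vbar fn //; lia.
Qed.

Lemma vbar_fix_nonpos f : vbar f = f -> in_vZ 0 f -> f = (f@_0)%:~R.
Proof.
move=> ff /in_vZP fn; apply/malgP=> k; rewrite mcoeff_intr intz.
have [k0|k0|<-] := ltgtP 0 k; [by apply: fn | | by []].
by rewrite -ff mcoeff_vbar fn //; lia.
Qed.

Lemma inverse_of_uniq (R : nzRingType) (a a' b : R) :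
  inverse_of a b -> inverse_of a' b -> a = a'.
Proof. by move=> [_ ba] [ab' _]; rewrite -[a]mul1r -ab' -mulrA ba mulr1. Qed.

Lemma sign_sqr (R : nzRingType) n : (-1) ^+ n * (-1) ^+ n = 1 :> R.
Proof. by rewrite -expr2 -signr_odd sqrr_sign. Qed.

Lemma scale_sign (A : algType Zv) n (h : A) : (-1) ^+ n * h = (-1) ^+ n *: h.
Proof.
by rewrite -signr_odd mulr_sign -[in RHS]signr_odd; case: (odd n);
  rewrite ?expr1 ?expr0 ?scaleN1r ?scale1r.
Qed.

Section HeckeAlgebra.
Variables (W : finGroupType) (S : {set W}) (L : W -> nat).
Hypothesis W_cox : coxeter_system S.
Hypothesis L_pos : forall s, s \in S -> (0 < L s)%N.
Variable H : hecke S L.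
Local Notation l := (len S).
Local Notation w0 := (longest S).
Local Notation T := (Tbasis H).
Local Notation C := (cbasis H).
Local Notation bar := (hbar H).
Local Notation dg := (dag H).
Local Notation q := (@qpar W L).
Implicit Types x y z w s t u : W.
Implicit Types a b h : H.

(** * The trace form *)

Definition tau h : Zv := bcoord T 1%g h.

Lemma tauD a b : tau (a + b) = tau a + tau b.
Proof. exact: bcoordD. Qed.

Lemma tauZ (f : Zv) a : tau (f *: a) = f * tau a.
Proof. exact: bcoordZ. Qed.

Lemma tau_sum (F : W -> H) : tau (\sum_x F x) = \sum_x tau (F x).
Proof. exact: bcoord_sum. Qed.

Lemma T_ind (P : H -> Prop) : P 1 ->
  (forall s h, s \in S -> P h -> P (T s * h)) -> forall w, P (T w).
Proof.
move=> P1 PS w; have [n le_wn] := ubnP (l w); elim: n => // n IHn in w le_wn *.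
have [->|w1] := eqVneq w 1%g; first by rewrite (T_1 W_cox).
have [s sS lw] := len_descent W_cox w1.
have -> : T w = T s * T (s * w)%g.
  by rewrite (T_up W_cox) ?mulgA ?(gen_sqr W_cox sS) ?mul1g.
by apply: PS => //; apply: IHn; lia.
Qed.

Lemma tau_TT x y : tau (T x * T y) = (x * y == 1)%g%:R.
Proof.
have [n le_xn] := ubnP (l x); elim: n => // n IHn in x y le_xn *.
have [->|x1] := eqVneq x 1%g.
  by rewrite (T_1 W_cox) mul1r mul1g /tau bcoord_bvec eq_sym.
have [|s sS lx] := len_descent W_cox (w := x^-1%g); first by rewrite invg_eq1.
rewrite (lenV W_cox) -(lenV W_cox (s * _)) invMg invgK (gen_inv W_cox sS) in lx.
set x' := (x * s)%g in lx.
have xE : (x = x' * s)%g by rewrite -mulgA (gen_sqr W_cox sS) mulg1.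
clearbody x'.
have lx' : (l x' < n)%N by lia.
have -> : T x = T x' * T s by rewrite (T_up_r W_cox) -?xE.
rewrite -mulrA; have [lsy|lsy] := len_mulS W_cox y sS.
  by rewrite (T_up W_cox) // IHn // xE mulgA.
rewrite (T_down W_cox) // mulrDr -scalerAr tauD tauZ.
rewrite !IHn // xE mulgA [X in _ + _ * X](_ : _ = 0) ?mulr0 ?addr0 //.
case: eqP => // /eqP; rewrite -eq_invg_mul => /eqP yE; move: lsy.
rewrite -yE -(lenV W_cox (s * _)) invMg invgK (gen_inv W_cox sS) -xE (lenV W_cox).
lia.
Qed.

Lemma tauM a b : tau (a * b) = \sum_x bcoord T x a * bcoord T x^-1%g b.
Proof.
rewrite {1}(bvecE T a) mulr_suml tau_sum; apply: eq_bigr => x _.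
rewrite -scalerAl tauZ; congr (_ * _).
rewrite {1}(bvecE T b) mulr_sumr tau_sum (bigD1 x^-1%g) //= -scalerAr tauZ.
rewrite tau_TT mulgV eqxx mulr1 big1 ?addr0 // => y yx.
by rewrite -scalerAr tauZ tau_TT -eq_invg_mul eq_sym (negPf yx) mulr0.
Qed.

Lemma tauC a b : tau (a * b) = tau (b * a).
Proof.
rewrite !tauM (reindex_inj invg_inj); apply: eq_bigr => x _.
by rewrite invgK mulrC.
Qed.

Lemma tau_Tl x h : tau (T x * h) = bcoord T x^-1%g h.
Proof.
rewrite tauM (bigD1 x) //= bcoord_bvec eqxx mul1r big1 ?addr0 // => y yx.
by rewrite bcoord_bvec (negPf yx) mul0r.
Qed.

(** * The bar involution and dagger *)

Lemma bar_T_mul x : bar (T x) * T x^-1%g = 1.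
Proof. by case: (hbar_Tbasis H x). Qed.

Lemma mul_bar_T x : T x^-1%g * bar (T x) = 1.
Proof. by case: (hbar_Tbasis H x). Qed.

Lemma dag_T x : dg (T x) = (-1) ^+ l x *: bar (T x).
Proof.
have := inverse_of_uniq (dag_Tbasis H x) (hbar_Tbasis H x).
by rewrite scale_sign => <-; rewrite scalerA sign_sqr scale1r.
Qed.

Lemma bar_sum (f : W -> Zv) (F : W -> H) :
  bar (\sum_x f x *: F x) = \sum_x vbar (f x) *: bar (F x).
Proof. by rewrite rmorph_sum; apply: eq_bigr => x _; rewrite hbarZ. Qed.

Lemma bar_sign n h : bar ((-1) ^+ n *: h) = (-1) ^+ n *: bar h.
Proof. by rewrite -!scale_sign rmorphM rmorphXn rmorphN1. Qed.

Lemma bar_dag h : bar (dg h) = dg (bar h).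
Proof.
rewrite (bvecE T h) linear_sum bar_sum /=.
under eq_bigr do rewrite linearZ.
rewrite bar_sum linear_sum /=; apply: eq_bigr => x _; rewrite linearZ /=; congr (_ *: _).
rewrite dag_T bar_sign hbarK.
apply: (@inverse_of_uniq _ _ _ (dg (T x^-1%g))).
  rewrite dag_T (lenV W_cox); split; rewrite -scalerAl -scalerAr scalerA.
    by rewrite sign_sqr scale1r -{1}[x]invgK mul_bar_T.
  by rewrite sign_sqr scale1r -{2}[x]invgK bar_T_mul.
by split; rewrite -rmorphM ?bar_T_mul ?mul_bar_T rmorph1.
Qed.

Lemma bar_dag_C x : bar (dg (C x)) = dg (C x).
Proof. by rewrite bar_dag cbasis_bar. Qed.

Lemma bcoord_bar h y : bcoord C y (bar h) = vbar (bcoord C y h).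
Proof.
rewrite {1}(bvecE C h) bar_sum.
by under eq_bigr do rewrite cbasis_bar; rewrite bcoordE.
Qed.

Lemma bar_fix_coord h : bar h = h -> forall y, vbar (bcoord C y h) = bcoord C y h.
Proof. by move=> hh y; rewrite -bcoord_bar hh. Qed.

Lemma pcoef_in_vZ0 y x : in_vZ 0 (pcoef H y x).
Proof.
have [->|yx] := eqVneq y x; last exact: in_vZ_trans (cbasis_offdiag H yx).
rewrite /pcoef cbasis_diag; apply/in_vZP => k k0; rewrite mcoeff_one.
by case: eqP k0 => // <-; rewrite ltxx.
Qed.

Lemma pcoef_at0 y x : (pcoef H y x)@_0 = (y == x)%:R.
Proof.
have [->|yx] := eqVneq y x; first by rewrite /pcoef cbasis_diag mcoeff_one eqxx.
by have /in_vZP -> := cbasis_offdiag H yx.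
Qed.

(** The c-coordinates of h are bar invariant. If n >= 0 is the largest exponent
    occurring in them, then the terms in v^n survive in the T-coordinates, since
    p_{y,x} contributes only negative powers off the diagonal. *)
Lemma bar_fix_neg_eq0 h : bar h = h ->
  (forall y, in_vZ (-1) (bcoord T y h)) -> h = 0.
Proof.
move=> hh hneg; pose f y := bcoord C y h.
suff f0 y : f y = 0 by apply: (bcoord_inj (b := C)) => y; rewrite bcoord0 -/(f y) f0.
have vf z : vbar (f z) = f z by apply: bar_fix_coord.
have hT z : bcoord T z h = \sum_u f u * pcoef H z u.
  by rewrite {1}(bvecE C h) bcoord_sum; apply: eq_bigr => u _; rewrite bcoordZ.
suff: forall n : nat, (forall z, in_vZ (n%:Z - 1) (f z)) -> f y = 0.
  pose N z := ex_minn (in_vZ_bound (f z)).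
  move/(_ (\max_z N z).+1); apply => z.
  have: in_vZ (N z)%:Z (f z) by rewrite /N; case: ex_minnP.
  by apply: in_vZ_trans; have := @leq_bigmax W N z; lia.
elim=> [|n IHn] fn; first by apply: vbar_fix_neg.
apply: IHn => z; apply/in_vZP => k nk.
have [kn|kn] := ltP n%:Z k; first by have /in_vZP -> := fn z; lia.
have {nk kn}-> : k = n%:Z + 0 by lia.
have := congr1 (mcoeff (n%:Z + 0)) (hT z).
have /in_vZP -> := hneg z; last by lia.
rewrite mcoeff_sum /=.
have fn' u : in_vZ n%:Z (f u) by apply: in_vZ_trans (fn u); lia.
under eq_bigr do rewrite (mcoeffM_top (fn' _) (pcoef_in_vZ0 _ _)) pcoef_at0.
rewrite (bigD1 z) //= eqxx mulr1 big1 ?addr0 => [->//|u uz].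
by rewrite eq_sym (negPf uz) mulr0.
Qed.

(** The criterion by which the symmetries of the algebra are shown to permute
    the c-basis. *)
Lemma C_uniq x h : bar h = h -> bcoord T x h = 1 ->
  (forall y, y != x -> in_vZ (-1) (bcoord T y h)) -> h = C x.
Proof.
move=> hh hx hy; apply/eqP; rewrite -subr_eq0; apply/eqP/bar_fix_neg_eq0.
  by rewrite rmorphB /= hh cbasis_bar.
move=> y; rewrite bcoordD -scaleN1r bcoordZ mulN1r.
have [->|yx] := eqVneq y x.
  by rewrite hx cbasis_diag subrr; apply/in_vZP=> k; rewrite mcoeff0.
have /in_vZP h1 := hy y yx; have /in_vZP h2 := cbasis_offdiag H yx.
by apply/in_vZP=> k k1; rewrite mcoeffB h1 ?h2 ?subr0.
Qed.

Lemma bar_T_gen s : s \in S -> bar (T s) = T s - (q s)%:A.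
Proof.
move=> sS; apply: inverse_of_uniq (hbar_Tbasis H s) _; rewrite (gen_inv W_cox sS).
split; rewrite ?mulrBl ?mulrBr (T_sqr H sS) // ?mulr_algl ?mulr_algr addrK //.
Qed.

Lemma C_gen s : s \in S -> C s = T s + ('v^(- (L s)%:Z))%:A.
Proof.
move=> sS; symmetry; have s1 : (s != 1)%g.
  by apply/eqP => s1; have := len_gen W_cox sS; rewrite s1 (len1 W_cox).
apply: C_uniq.
- rewrite rmorphD /= bar_T_gen // hbarZ rmorph1 vbar_vpow opprK.
  by rewrite /qpar scalerBl opprB addrA subrK.
- rewrite bcoordD bcoordZ -(T_1 W_cox) !bcoord_bvec eqxx (negPf s1).
  by rewrite mulr0 addr0.
move=> y ys; rewrite bcoordD bcoordZ -(T_1 W_cox) !bcoord_bvec (negPf ys) add0r.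
apply/in_vZP=> k k1; case: eqP => _; rewrite ?mulr1 ?mulr0 ?mcoeff0 //.
by rewrite mcoeff_vpow; case: eqP => // ks; have := L_pos sS; lia.
Qed.

End HeckeAlgebra.

Section Symmetries.
Variables (W : finGroupType) (S : {set W}) (L : W -> nat).
Hypothesis W_cox : coxeter_system S.
Hypothesis L_pos : forall s, s \in S -> (0 < L s)%N.
Variable H : hecke S L.
Local Notation l := (len S).
Local Notation w0 := (longest S).
Local Notation T := (Tbasis H).
Local Notation C := (cbasis H).
Local Notation bar := (hbar H).
Local Notation dg := (dag H).
Local Notation tau := (@tau W S L H).
Local Notation hc := (hcoef H).
Local Notation p := (pcoef H).
Implicit Types x y z w s t u : W.
Implicit Types a b h : H.

(** * The anti-automorphism *)

(** The anti-automorphism T_x |-> T_{x^-1}, which exchanges left and right. *)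
Definition flat h : H := \sum_x bcoord T x h *: T x^-1%g.

Lemma flatD a b : flat (a + b) = flat a + flat b.
Proof.
by rewrite /flat -big_split; apply: eq_bigr => x _ /=; rewrite bcoordD scalerDl.
Qed.

Lemma flatZ (f : Zv) a : flat (f *: a) = f *: flat a.
Proof. by rewrite /flat scaler_sumr; apply: eq_bigr => x _; rewrite bcoordZ scalerA. Qed.

Lemma flat0 : flat 0 = 0.
Proof. by rewrite -(scale0r 0) flatZ !scale0r. Qed.

Lemma flat_sum (F : W -> H) : flat (\sum_x F x) = \sum_x flat (F x).
Proof. exact: (big_morph flat flatD flat0). Qed.

Lemma flat_T x : flat (T x) = T x^-1%g.
Proof.
rewrite /flat (bigD1 x) //= bcoord_bvec eqxx scale1r big1 ?addr0 // => y yx.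
by rewrite bcoord_bvec (negPf yx) scale0r.
Qed.

Lemma flat1 : flat 1 = 1.
Proof. by rewrite -(T_1 W_cox) flat_T invg1. Qed.

Lemma bcoord_flat y h : bcoord T y (flat h) = bcoord T y^-1%g h.
Proof.
rewrite /flat (reindex_inj invg_inj) /=.
by under eq_bigr do rewrite invgK; rewrite bcoordE.
Qed.

Lemma flatM a b : flat (a * b) = flat b * flat a.
Proof.
have gen s c : s \in S -> flat (T s * c) = flat c * T s.
  move=> sS; rewrite {1}(bvecE T c) mulr_sumr flat_sum [flat c]/flat mulr_suml.
  apply: eq_bigr => y _; rewrite -scalerAr flatZ -scalerAl; congr (_ *: _).
  have ysE : (y^-1 * s = (s * y)^-1)%g by rewrite invMg (gen_inv W_cox sS).
  have [lsy|lsy] := len_mulS W_cox y sS.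
    by rewrite (T_up W_cox) // flat_T (T_up_r W_cox) ?ysE ?(lenV W_cox).
  rewrite (T_down W_cox) // flatD flatZ !flat_T (T_down_r W_cox) ?ysE //.
  by rewrite !(lenV W_cox).
have Tw w c : flat (T w * c) = flat c * flat (T w).
  apply: (T_ind W_cox (P := fun h => forall c, flat (h * c) = flat c * flat h)).
    by move=> d; rewrite flat1 mul1r mulr1.
  move=> s h sS IH d; by rewrite -mulrA (gen _ (h * d)) // IH -mulrA (gen _ h).
rewrite {1}(bvecE T a) mulr_suml flat_sum {2}(bvecE T a) flat_sum mulr_sumr.
by apply: eq_bigr => x _; rewrite -scalerAl !flatZ Tw -scalerAr.
Qed.

Lemma bar_flat h : bar (flat h) = flat (bar h).
Proof.
rewrite {1}/flat bar_sum {2}(bvecE T h) bar_sum flat_sum.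
apply: eq_bigr => x _; rewrite flatZ; congr (_ *: _).
apply: inverse_of_uniq (hbar_Tbasis H x^-1%g) _.
rewrite -(flat_T x^-1%g).
by split; rewrite -flatM ?mul_bar_T ?bar_T_mul flat1.
Qed.

Lemma flat_C x : flat (C x) = C x^-1%g.
Proof.
apply: C_uniq; first by rewrite bar_flat cbasis_bar.
  by rewrite bcoord_flat invgK cbasis_diag.
move=> y yx; rewrite bcoord_flat; apply: cbasis_offdiag.
by rewrite (can2_eq invgK invgK).
Qed.

Lemma hcoef_flat x y z : hc y^-1%g x^-1%g z^-1%g = hc x y z.
Proof.
rewrite /hcoef -!flat_C -flatM {1}(bvecE C (C x * C y)) flat_sum.
under eq_bigr do rewrite flatZ flat_C.
by rewrite (reindex_inj invg_inj) /=; under eq_bigr do rewrite invgK; rewrite bcoordE invgK.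
Qed.

(** * Conjugation by the basis element of the longest element *)

Lemma Tw0_T x : T w0 * T x = T (w0 * x * w0)%g * T w0.
Proof.
have e1 : T (w0 * x^-1)%g * T x = T w0.
  rewrite Tbasis_mul mulgKV // -(len_mul_longest W_cox L_pos H x^-1%g).
  by rewrite (lenV W_cox).
have e2 : T (w0 * x * w0)%g * T (w0 * x^-1)%g = T w0.
  have e : (w0 * x * w0 * (w0 * x^-1) = w0)%g.
    by rewrite !mulgA -[(w0 * x * w0 * w0)%g]mulgA (longestK W_cox L_pos H) mulg1 mulgK.
  rewrite Tbasis_mul e //.
  have := len_longest_mul W_cox L_pos H (w0 * x)%g; have := len_mul_longest W_cox L_pos H x.
  have := len_mul_longest W_cox L_pos H x^-1%g; rewrite (lenV W_cox); lia.
by rewrite -{1}e2 -mulrA e1.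
Qed.

Lemma conj_w0K x : (w0 * (w0 * x * w0) * w0 = x)%g.
Proof.
by rewrite !mulgA (longestK W_cox L_pos H) mul1g -mulgA (longestK W_cox L_pos H) mulg1.
Qed.

Lemma conj_w0_inj : injective (fun x => w0 * x * w0)%g.
Proof. by move=> x y /= e; rewrite -(conj_w0K x) e conj_w0K. Qed.

Lemma bar_Tw0 : bar (T w0) * T w0 = 1.
Proof. by have := bar_T_mul H w0; rewrite (longestV W_cox L_pos H). Qed.

Lemma Tw0_bar : T w0 * bar (T w0) = 1.
Proof. by have := mul_bar_T H w0; rewrite (longestV W_cox L_pos H). Qed.

Definition conjTw0 h : H := T w0 * h * bar (T w0).

Lemma conjTw0_T x : conjTw0 (T x) = T (w0 * x * w0)%g.
Proof. by rewrite /conjTw0 Tw0_T -mulrA Tw0_bar mulr1. Qed.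

Lemma conjTw0_sum (f : W -> Zv) (F : W -> H) :
  conjTw0 (\sum_x f x *: F x) = \sum_x f x *: conjTw0 (F x).
Proof.
rewrite /conjTw0 mulr_sumr mulr_suml; apply: eq_bigr => x _.
by rewrite -scalerAr -scalerAl.
Qed.

Lemma conjTw0M a b : conjTw0 (a * b) = conjTw0 a * conjTw0 b.
Proof. by rewrite /conjTw0 -!mulrA [bar _ * (_ * _)]mulrA bar_Tw0 mul1r. Qed.

Lemma Tw0_sqr_central h : T w0 * T w0 * h = h * (T w0 * T w0).
Proof.
rewrite (bvecE T h) mulr_sumr mulr_suml; apply: eq_bigr => x _.
rewrite -scalerAr -scalerAl -mulrA (Tw0_T x) mulrA (Tw0_T (w0 * x * w0)).
by rewrite conj_w0K mulrA.
Qed.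

(** The bar involution turns conjugation by T_{w0} into conjugation by its
    inverse, which is the same map since T_{w0}^2 is central. *)
Lemma bar_conjTw0 h : bar (conjTw0 h) = conjTw0 (bar h).
Proof.
rewrite /conjTw0 !rmorphM /= hbarK.
rewrite -[LHS]mulr1 -Tw0_bar !mulrA -[_ * T w0 * T w0]mulrA -[_ * (T w0 * T w0)]mulrA.
by rewrite -Tw0_sqr_central !mulrA bar_Tw0 mul1r.
Qed.

Lemma bcoord_conjTw0 y h : bcoord T y (conjTw0 h) = bcoord T (w0 * y * w0)%g h.
Proof.
rewrite {1}(bvecE T h) conjTw0_sum (reindex_inj conj_w0_inj) /=.
under eq_bigr do rewrite conjTw0_T conj_w0K.
by rewrite bcoordE.
Qed.

Lemma conjTw0_C x : conjTw0 (C x) = C (w0 * x * w0)%g.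
Proof.
apply: C_uniq; first by rewrite bar_conjTw0 cbasis_bar.
  by rewrite bcoord_conjTw0 conj_w0K cbasis_diag.
move=> y yx; rewrite bcoord_conjTw0; apply: cbasis_offdiag.
by apply: contraNneq yx => <-; rewrite conj_w0K.
Qed.

Lemma hcoef_conj_w0 x y z :
  hc (w0 * x * w0)%g (w0 * y * w0)%g (w0 * z * w0)%g = hc x y z.
Proof.
rewrite /hcoef -!conjTw0_C -conjTw0M {1}(bvecE C (C x * C y)) conjTw0_sum.
rewrite (reindex_inj conj_w0_inj) /=.
by under eq_bigr do rewrite conjTw0_C conj_w0K; rewrite bcoordE conj_w0K.
Qed.

(** * The dual basis *)

Lemma dag_T_mul x : dg (T x) * T x^-1%g = ((-1) ^+ l x)%:A.
Proof. by rewrite dag_T -scalerAl bar_T_mul. Qed.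

Lemma dag_T_Tw0 u : dg (T u) * T w0 = (-1) ^+ l u *: T (u * w0)%g.
Proof.
have -> : T w0 = T u^-1%g * T (u * w0)%g.
  rewrite Tbasis_mul mulKg // (lenV W_cox) addnC.
  by rewrite (len_longest_mul W_cox L_pos H).
by rewrite mulrA dag_T_mul mulr_algl.
Qed.

(** Up to sign these elements form the basis dual to the c-basis for the trace
    form (tau_C_dualC). *)
Definition dualC w : H := dg (C w) * T w0.

Lemma bcoord_dualC y w : bcoord T y (dualC w) = (-1) ^+ l (y * w0)%g * p (y * w0)%g w.
Proof.
rewrite /dualC {1}(bvecE T (C w)) linear_sum mulr_suml /=.
have w0K : cancel (mulg^~ w0) (mulg^~ w0).
  by move=> x; rewrite -mulgA (longestK W_cox L_pos H) mulg1.
rewrite (reindex_inj (can_inj w0K)) /=.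
under eq_bigr do rewrite linearZ -scalerAl dag_T_Tw0 scalerA w0K.
by rewrite bcoordE mulrC.
Qed.

(** As T_{w0} bar(T_y) = T_{w0 y}, the bar involution does not change the
    coefficient of T_{w0} except through the scalars. *)
Lemma tau_Tw0_bar h : tau (T w0 * bar h) = vbar (tau (T w0 * h)).
Proof.
rewrite (tau_Tl W_cox) (longestV W_cox L_pos H) {1}(bvecE T h) bar_sum bcoord_sum.
have vsum (F : W -> Zv) : vbar (\sum_x F x) = \sum_x vbar (F x).
  by apply: (big_morph vbar vbarD); rewrite -[0]/(0%:R) vbar_nat.
rewrite (tau_Tl W_cox) (longestV W_cox L_pos H) {2}(bvecE T h) bcoord_sum vsum.
apply: eq_bigr => y _; rewrite !bcoordZ bcoord_bvec.
have -> : bcoord T w0 (bar (T y)) = (w0 == y)%:R.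
  rewrite -{1}(longestV W_cox L_pos H) -(tau_Tl W_cox).
  have -> : T w0 = T (w0 * y)%g * T y^-1%g.
    rewrite Tbasis_mul mulgK // (lenV W_cox).
    by rewrite (len_mul_longest W_cox L_pos H).
  rewrite -mulrA mul_bar_T mulr1 /tau bcoord_bvec; congr (_ %:R); rewrite eq_sym -eq_invg_mul.
  by rewrite (longestV W_cox L_pos H).
case: eqP => _; first by rewrite !mulr1.
by rewrite !mulr0 -[0]/(0%:R) vbar_nat.
Qed.

Lemma mcoeff_sign n (f : Zv) k : ((-1) ^+ n * f)@_k = (-1) ^+ n * f@_k.
Proof.
by rewrite -signr_odd -[in RHS]signr_odd; case: (odd n);
  rewrite ?expr1 ?expr0 ?mulN1r ?mul1r ?mcoeffN.
Qed.

Lemma in_vZ_sign n k (f : Zv) : in_vZ k f -> in_vZ k ((-1) ^+ n * f).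
Proof.
by move=> /in_vZP fk; apply/in_vZP=> j /fk fj; rewrite mcoeff_sign fj mulr0.
Qed.

(** The left side lies in Z[v^-1], as a sum of products of two polynomials p. It
    is also bar invariant, being the pairing of T_{w0} with the bar invariant
    element c_x c_w^dag. Hence it is its own constant term. *)
Lemma tau_C_dualC x w : tau (C x * dualC w) = (-1) ^+ l w * (x^-1 * w0 == w)%g%:R.
Proof.
set f := tau _.
have ff : vbar f = f.
  have fE : f = tau (T w0 * (C x * dg (C w))).
    by rewrite /f /dualC [C x * _]mulrA [LHS](tauC W_cox).
  rewrite fE -tau_Tw0_bar; congr (tau (_ * _)).
  by rewrite rmorphM /= cbasis_bar (bar_dag_C W_cox).
have hT y : in_vZ 0 (bcoord T y^-1%g (dualC w)).
  by rewrite bcoord_dualC in_vZ_sign // pcoef_in_vZ0.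
have fM y : (p y x * bcoord T y^-1%g (dualC w))@_0 =
    (y == x)%:R * (-1) ^+ l w * (y^-1 * w0 == w)%g%:R.
  rewrite -[0](addr0 0) (mcoeffM_top (pcoef_in_vZ0 _ _ _) (hT y)) bcoord_dualC.
  rewrite mcoeff_sign !pcoef_at0 mulrA; case: (eqVneq (y^-1 * w0)%g w) => [->|_] //.
  by rewrite !mulr0.
have fE : f = \sum_y p y x * bcoord T y^-1%g (dualC w) by rewrite /f (tauM W_cox).
have f0 : f@_0 = (-1) ^+ l w * (x^-1 * w0 == w)%g%:R.
  rewrite fE mcoeff_sum /=; under eq_bigr do rewrite fM.
  rewrite (bigD1 x) //= eqxx mul1r big1 ?addr0 // => y /negPf->.
  by rewrite !mul0r.
rewrite (vbar_fix_nonpos ff) ?f0; first by rewrite rmorphM rmorphXn rmorphN1 /= rmorph_nat.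
apply/in_vZP=> k k0; rewrite fE mcoeff_sum big1 // => y _ /=.
by have /in_vZP -> := in_vZM (pcoef_in_vZ0 H y x) (hT y).
Qed.

Lemma bcoord_C_tau z h :
  bcoord C z h = (-1) ^+ l (z^-1 * w0)%g * tau (h * dualC (z^-1 * w0)%g).
Proof.
rewrite {2}(bvecE C h) mulr_suml tau_sum (bigD1 z) //= -scalerAl tauZ tau_C_dualC eqxx mulr1.
rewrite big1 ?addr0.
  by rewrite mulrCA sign_sqr mulr1.
move=> y yz; rewrite -scalerAl tauZ tau_C_dualC.
by rewrite (inj_eq (mulIg w0)) (inj_eq invg_inj) (negPf yz) !mulr0.
Qed.

(** The Kazhdan-Lusztig inversion formula for the matrix p, at the row of the
    longest element. *)
Lemma bcoord_C_Tw0 z :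
  bcoord C z (T w0) = (-1) ^+ l (z^-1 * w0)%g * p 1%g (z^-1 * w0)%g.
Proof.
rewrite bcoord_C_tau (tau_Tl W_cox) (longestV W_cox L_pos H) bcoord_dualC.
by rewrite (longestK W_cox L_pos H) (len1 W_cox) expr0 mul1r.
Qed.

(** T_{w0}^dag is the inverse of T_{w0} up to sign, which is how the dagger basis
    enters. *)
Lemma bar_Tw0_expand :
  bar (T w0) = (-1) ^+ l w0 *:
    \sum_z ((-1) ^+ l (z^-1 * w0)%g * p 1%g (z^-1 * w0)%g) *: dg (C z).
Proof.
have -> : bar (T w0) = (-1) ^+ l w0 *: dg (T w0).
  by rewrite dag_T scalerA sign_sqr scale1r.
rewrite {1}(bvecE C (T w0)) linear_sum /=; congr (_ *: _).
by apply: eq_bigr => z _; rewrite linearZ /= bcoord_C_Tw0.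
Qed.

(** Left multiplication by c_y on the dual basis is the transpose of right
    multiplication by c_y on the c-basis. *)
Lemma C_mul_dualC y w :
  C y * dualC w = \sum_x
    ((-1) ^+ (l w + l (x^-1 * w0)%g) * hc x y (w0 * w^-1)%g) *: dualC (x^-1 * w0)%g.
Proof.
have inj a b : (forall x, tau (C x * a) = tau (C x * b)) -> a = b.
  move=> ab; apply: (bcoord_inj (b := T)) => y'.
  rewrite -[y']invgK -!(tau_Tl W_cox) {1 2}(bvecE C (T _)) !mulr_suml !tau_sum.
  by apply: eq_bigr => x _; rewrite -!scalerAl !tauZ ab.
apply: inj => u; rewrite mulr_sumr tau_sum (bigD1 u) //= -scalerAr tauZ tau_C_dualC eqxx mulr1.
rewrite [X in _ + X]big1 ?addr0 => [|x xu]; last first.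
  rewrite -scalerAr tauZ tau_C_dualC (inj_eq (mulIg w0)) (inj_eq invg_inj).
  by rewrite eq_sym (negPf xu) !mulr0.
rewrite /hcoef bcoord_C_tau invMg invgK (longestV W_cox L_pos H) -mulgA.
rewrite (longestK W_cox L_pos H) mulg1 exprD mulrACA sign_sqr mul1r mulrAC sign_sqr.
by rewrite mul1r mulrA.
Qed.

End Symmetries.

(** * The preorders and the longest element *)

Lemma connect_least (X : finType) (e : rel X) (r : rel X) :
  reflexive r -> transitive r -> subrel e r -> subrel (connect e) r.
Proof.
move=> r_refl r_trans er x y /connectP[pth]; elim: pth x => [|z pth IH] x /=.
  by move=> _ ->.
by case/andP=> /er xz /IH{}IH /IH; apply: r_trans.
Qed.

Lemma sum_neq0_ex (V : zmodType) (I : finType) (F : I -> V) :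
  \sum_i F i != 0 -> exists i, F i != 0.
Proof.
move=> nz; apply/existsP; apply: contraNT nz => /existsPn F0.
by rewrite big1 // => i _; apply/eqP; rewrite -[_ == _]negbK F0.
Qed.

Section CellOrder.
Variables (W : finGroupType) (S : {set W}) (L : W -> nat).
Hypothesis W_cox : coxeter_system S.
Hypothesis L_pos : forall s, s \in S -> (0 < L s)%N.
Variable H : hecke S L.
Local Notation w0 := (longest S).
Local Notation T := (Tbasis H).
Local Notation C := (cbasis H).
Local Notation dg := (dag H).
Local Notation hc := (hcoef H).
Local Notation leL := (leL H).
Local Notation leR := (leR H).
Local Notation leLR := (leLR H).
Implicit Types x y z w s t u : W.

Lemma leL_refl : reflexive leL. Proof. by move=> x; apply: connect0. Qed.
Lemma leL_trans : transitive leL. Proof. exact: connect_trans. Qed.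

Definition leL_supp y (h : H) : Prop := forall z, bcoord C z h != 0 -> leL z y.

Lemma leL_suppD y a b : leL_supp y a -> leL_supp y b -> leL_supp y (a + b).
Proof.
move=> ya yb z; rewrite bcoordD; have [->|/ya //] := eqVneq (bcoord C z a) 0.
by rewrite add0r => /yb.
Qed.

Lemma leL_suppZ y (f : Zv) a : leL_supp y a -> leL_supp y (f *: a).
Proof.
move=> ya z; rewrite bcoordZ => nz; apply: ya.
by apply: contraNneq nz => ->; rewrite mulr0.
Qed.

Lemma leL_supp_C x : leL_supp x (C x).
Proof.
move=> z; rewrite bcoord_bvec; case: (eqVneq z x) => [-> _|_]; first exact: leL_refl.
by rewrite eqxx.
Qed.

Lemma leL_supp_sum y (F : W -> H) : (forall x, leL_supp y (F x)) -> leL_supp y (\sum_x F x).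
Proof.
move=> yF; elim/big_ind: _ => //; last exact: leL_suppD.
by move=> z; rewrite bcoord0 eqxx.
Qed.

(** For the generators c_s this is the definition of the preorder. *)
Lemma leL_supp_mul y a h : leL_supp y h -> leL_supp y (a * h).
Proof.
have genC s h' : s \in S -> leL_supp y h' -> leL_supp y (C s * h').
  move=> sS yh z; rewrite (bvecE C h') mulr_sumr bcoord_sum => /sum_neq0_ex[u].
  rewrite -scalerAr bcoordZ => nz; apply: (@leL_trans u).
    apply: connect1; apply/existsP; exists s; rewrite sS /=.
    by apply: contraNneq nz; rewrite /hcoef => ->; rewrite mulr0.
  by apply: yh; apply: contraNneq nz => ->; rewrite mul0r.
have genT s h' : s \in S -> leL_supp y h' -> leL_supp y (T s * h').
  move=> sS yh; have -> : T s = C s + (- 'v^(- (L s)%:Z))%:A.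
    by rewrite (C_gen W_cox L_pos) // scaleNr addrK.
  rewrite mulrDl mulr_algl; apply: leL_suppD; first exact: genC.
  exact: leL_suppZ.
have mulT w : forall h', leL_supp y h' -> leL_supp y (T w * h').
  apply: (T_ind W_cox (P := fun k => forall h', leL_supp y h' -> leL_supp y (k * h'))).
    by move=> h' yh; rewrite mul1r.
  by move=> s k sS IH h' yh; rewrite -mulrA; apply: genT => //; apply: IH.
move=> yh; rewrite (bvecE T a) mulr_suml; apply: leL_supp_sum => x.
by rewrite -scalerAl; apply/leL_suppZ/mulT.
Qed.

Lemma hcoef_leL x y z : hc x y z != 0 -> leL z y.
Proof. by apply: leL_supp_mul; apply: leL_supp_C. Qed.

Lemma hcoef_leR x y z : hc x y z != 0 -> leR z x.
Proof. by rewrite -hcoef_flat // => /hcoef_leL. Qed.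

(** Removing the dagger from C_mul_dualC shows that c_{x^-1 w0} occurs in a
    left multiple of c_{z^-1 w0}. This is why w0 reverses the preorders. *)
Lemma hcoef_w0 x y z : hc x y z != 0 -> leL (x^-1 * w0)%g (z^-1 * w0)%g.
Proof.
move=> nz; have [dgi dgK dgiK] := dag_bij H.
set w := (z^-1 * w0)%g.
have zE : (w0 * w^-1 = z)%g.
  by rewrite invMg invgK (longestV W_cox L_pos H) mulgA (longestK W_cox L_pos H) mul1g.
pose c x := (-1) ^+ (len S w + len S (x^-1 * w0)%g) * hc x y z.
have e : dgi (C y) * C w = \sum_x c x *: C (x^-1 * w0)%g.
  apply: (can_inj dgK); rewrite rmorphM /= dgiK linear_sum /=.
  have := congr1 (fun h => h * hbar H (T w0)) (C_mul_dualC W_cox L_pos H y w).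
  rewrite /dualC mulrA -[_ * T w0 * _]mulrA (Tw0_bar W_cox L_pos) mulr1 => ->.
  rewrite mulr_suml; apply: eq_bigr => u _.
  by rewrite linearZ /= -scalerAl -mulrA (Tw0_bar W_cox L_pos) mulr1 zE.
have /(_ (x^-1 * w0)%g) : leL_supp w (dgi (C y) * C w).
  by apply: leL_supp_mul; apply: leL_supp_C.
apply; rewrite e bcoord_sum (bigD1 x) //= bcoordZ bcoord_bvec eqxx mulr1.
rewrite big1 ?addr0 => [|u ux]; last first.
  rewrite bcoordZ bcoord_bvec (inj_eq (mulIg w0)) (inj_eq invg_inj) eq_sym.
  by rewrite (negPf ux) mulr0.
by rewrite /c -signr_odd; case: (odd _); rewrite ?expr1 ?expr0 ?mulN1r ?mul1r ?oppr_eq0.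
Qed.

Lemma leL_mul_w0 w w' : leL w w' -> leL (w' * w0)%g (w * w0)%g.
Proof.
apply: (connect_least (r := fun w w' => leL (w' * w0)%g (w * w0)%g)).
- by move=> x; apply: leL_refl.
- by move=> y x z xy yz; apply: leL_trans yz xy.
move=> x y /existsP[s /andP[sS]]; rewrite -hcoef_flat // => /hcoef_w0.
by rewrite !invgK.
Qed.

Lemma leL_conj_w0 w w' : leL w w' -> leL (w0 * w * w0)%g (w0 * w' * w0)%g.
Proof.
apply: (connect_least (r := fun w w' => leL (w0 * w * w0)%g (w0 * w' * w0)%g)).
- by move=> x; apply: leL_refl.
- by move=> y x z; apply: leL_trans.
move=> x y /existsP[s /andP[sS]]; rewrite -(hcoef_conj_w0 W_cox L_pos).
exact: hcoef_leL.
Qed.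

Lemma leL_w0_mul w w' : leL w w' -> leL (w0 * w')%g (w0 * w)%g.
Proof.
move=> /leL_mul_w0/leL_conj_w0; rewrite !mulgA -![(_ * w0 * w0)%g]mulgA.
by rewrite (longestK W_cox L_pos H) !mulg1.
Qed.

Lemma leL_leLR x y : leL x y -> leLR x y.
Proof. by move=> xy; apply: connect1; rewrite xy. Qed.

Lemma leR_leLR x y : leR x y -> leLR x y.
Proof. by move=> xy; apply: connect1; rewrite xy orbT. Qed.

Lemma leLR_mul_w0 w w' : leLR w w' -> leLR (w' * w0)%g (w * w0)%g.
Proof.
apply: (connect_least (r := fun w w' => leLR (w' * w0)%g (w * w0)%g)).
- by move=> x; apply: connect0.
- by move=> y x z xy yz; apply: connect_trans yz xy.
move=> x y /orP[/leL_mul_w0/leL_leLR //|/leL_w0_mul xy].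
by apply: leR_leLR; rewrite /Defs.leR !invMg (longestV W_cox L_pos H).
Qed.

Lemma eqL_w0_mul w w' : eqL H w w' -> eqL H (w0 * w)%g (w0 * w')%g.
Proof. by case/andP=> ww' w'w; apply/andP; split; apply: leL_w0_mul. Qed.

Lemma eqLR_mul_w0 w w' : eqLR H w w' -> eqLR H (w * w0)%g (w' * w0)%g.
Proof. by case/andP=> ww' w'w; apply/andP; split; apply: leLR_mul_w0. Qed.

End CellOrder.

(** * Leading coefficients *)

(** The coefficient of a power of the second indeterminate v'. *)
Definition coefv' (k : int) (F : laurent Zv) : Zv := F@_k.

Lemma coefv'_sum (I : finType) k (F : I -> laurent Zv) :
  coefv' k (\sum_i F i) = \sum_i coefv' k (F i).
Proof. exact: mcoeff_sum. Qed.

Lemma coefv'_in_v' f k : coefv' k (in_v' f) = (f@_k)%:~R.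
Proof.
rewrite /coefv' /in_v' mmapE mcoeff_sum /=.
have E (i : int) : ((f@_i)%:~R * vpow Zv i : laurent Zv)@_k = (f@_i)%:~R *+ (i == k).
  rewrite mcoeffM_vpow mcoeff_intr.
  by congr (_ *+ nat_of_bool _); rewrite eq_sym subr_eq0 eq_sym.
under eq_bigr do rewrite E.
case: (boolP (k \in msupp f)) => kf.
  rewrite (big_fsetD1 k) //= eqxx mulr1n big1_seq ?addr0 // => i.
  by rewrite /= in_fsetD1 => /andP[/negPf-> _].
rewrite (mcoeff_outdom kf) big1_seq // => i /= If.
by case: eqP => // ik; case/negP: kf; rewrite -ik.
Qed.

Lemma coefv'M_in_v (f : Zv) (F : laurent Zv) k : coefv' k (F * in_v f) = coefv' k F * f.
Proof.
rewrite /coefv'; have -> : in_v f = << f *g 0 >> by [].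
rewrite mulrC mcoeffM_laurent msuppU.
case: eqP => [->|_]; first by rewrite big_seq_fset0 mulr0.
by rewrite big_seq_fset1 mcoeffUU subr0 mulrC.
Qed.

Lemma coefv'_in_v'M (f g : Zv) k : coefv' k (in_v' f * in_v g) = (f@_k)%:~R * g.
Proof. by rewrite coefv'M_in_v coefv'_in_v'. Qed.

Lemma coefv'M_in_v' (f g : Zv) k : coefv' k (in_v g * in_v' f) = g * (f@_k)%:~R.
Proof. by rewrite [in_v g * _]mulrC coefv'_in_v'M mulrC. Qed.

Lemma in_vZ_topdeg f : in_vZ (topdeg f) f.
Proof.
apply/allP => k; rewrite -(mem_sort <=%R) /topdeg.
have := sort_sorted (@le_total _ int) (msupp f).
elim/last_ind: (sort _ _) => // s x _.
rewrite last_rcons mem_rcons (sorted_pairwise le_trans) pairwise_rcons => /andP[/allP sx _].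
by rewrite in_cons => /orP[/eqP-> //|/sx].
Qed.

Lemma le_topdeg f k : f@_k != 0 -> k <= topdeg f.
Proof. by rewrite mcoeff_neq0; have /allP := in_vZ_topdeg f; apply. Qed.

(** * The ring J as a module over the Hecke algebra *)

Section Asymptotic.
Variables (W : finGroupType) (S : {set W}) (L : W -> nat).
Hypothesis W_cox : coxeter_system S.
Hypothesis L_pos : forall s, s \in S -> (0 < L s)%N.
Variable H : hecke S L.
Hypothesis H_P : propertiesP H.
Local Notation w0 := (longest S).
Local Notation T := (Tbasis H).
Local Notation C := (cbasis H).
Local Notation dg := (dag H).
Local Notation hc := (hcoef H).
Local Notation leL := (leL H).
Local Notation leLR := (leLR H).
Local Notation eqL := (eqL H).
Local Notation eqLR := (eqLR H).
Local Notation a := (afun H).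
Local Notation D := (Dset H).
Local Notation gam := (gamma H).
Local Notation nc := (ncoef H).
Local Notation dL := (dL H).
Implicit Types x y z w s t u d : W.

Lemma gammaE x y z : gam x y z^-1%g = (hc x y z)@_((a z)%:Z).
Proof. by rewrite /gamma invgK. Qed.

Lemma hcoef_in_vZ x y z : in_vZ (a z)%:Z (hc x y z).
Proof. by rewrite /afun; case: ex_minnP => n /forallP/(_ x)/forallP/(_ y). Qed.

Lemma eqL_refl x : eqL x x.
Proof. by rewrite /Defs.eqL leL_refl. Qed.

Lemma eqL_sym x y : eqL x y = eqL y x.
Proof. by rewrite /Defs.eqL andbC. Qed.

Lemma eqL_trans : transitive eqL.
Proof.
move=> y x z /andP[xy yx] /andP[yz zy]; apply/andP.
by split; [apply: leL_trans yz | apply: leL_trans yx].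
Qed.

Lemma eqLR_trans : transitive eqLR.
Proof.
move=> y x z /andP[xy yx] /andP[yz zy]; apply/andP.
by split; [apply: connect_trans yz | apply: connect_trans yx].
Qed.

Lemma eqLR_sym x y : eqLR x y = eqLR y x.
Proof. by rewrite /Defs.eqLR andbC. Qed.

Lemma eqLR_refl x : eqLR x x.
Proof. by rewrite /Defs.eqLR /Defs.leLR connect0. Qed.

Lemma a_leLR x y : leLR x y -> (a y <= a x)%N.
Proof. exact: (P4 H_P). Qed.

Lemma a_eqLR x y : eqLR x y -> a x = a y.
Proof. by case/andP=> xy yx; apply/eqP; rewrite eqn_leq !a_leLR. Qed.

Lemma eqL_eqLR x y : eqL x y -> eqLR x y.
Proof. by case/andP=> xy yx; rewrite /Defs.eqLR !leL_leLR. Qed.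

Lemma a_eqL x y : eqL x y -> a x = a y.
Proof. by move/eqL_eqLR/a_eqLR. Qed.

Lemma a_inv x : a x^-1%g = a x.
Proof. exact/esym/a_eqLR/(P14 H_P). Qed.

Lemma DsetV d : d \in D -> d^-1%g = d.
Proof.
by move=> dD; apply/eqP; rewrite eq_invg_mul -(P6 H_P dD) expgS expg1.
Qed.

Lemma dL_spec x : dL x \in D /\ eqL x (dL x).
Proof.
rewrite /Defs.dL; case: pickP => [d /andP[] //|none].
have [d [[[dD dG] _] _]] : exists d,
    unique (fun d => d \in D /\ d \in [set z in [set: W] | eqL x z]) d /\
    {in [set z in [set: W] | eqL x z], forall z, gam z^-1%g z d != 0}.
  by apply: (P13 H_P); apply: imset_f; rewrite inE.
by have := none d; rewrite dD /=; move: dG; rewrite !inE /= => ->.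
Qed.

Lemma dL_D x : dL x \in D. Proof. exact: (dL_spec x).1. Qed.
Lemma eqL_dL x : eqL x (dL x). Proof. exact: (dL_spec x).2. Qed.

Lemma left_cell_D d x : d \in D -> eqL x d -> dL x = d /\ gam x^-1%g x d != 0.
Proof.
move=> dD xd; have [d' [[_ d'u] d'g]] : exists d',
    unique (fun d => d \in D /\ d \in [set z in [set: W] | eqL x z]) d' /\
    {in [set z in [set: W] | eqL x z], forall z, gam z^-1%g z d' != 0}.
  by apply: (P13 H_P); apply: imset_f; rewrite inE.
have d'd : d' = d by apply: d'u; rewrite dD !inE.
split; last by rewrite -d'd d'g // !inE eqL_refl.
by rewrite -d'd; apply/esym/d'u; rewrite dL_D !inE eqL_dL.
Qed.

Lemma gamma_D d x : d \in D -> eqL x d -> gam x^-1%g x d = nc d /\ nc d * nc d = 1.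
Proof.
move=> dD /(left_cell_D dD)[_ g].
by have [-> [->|->]] := P5 H_P dD g.
Qed.

Lemma ncoef_sqr d : d \in D -> nc d * nc d = 1.
Proof. by move=> dD; case: (gamma_D dD (eqL_refl d)). Qed.

Lemma gamma_DE d x y : d \in D ->
  gam x y d = ((x == y^-1)%g && (dL y == d))%:R * nc d.
Proof.
move=> dD; case: (boolP (_ && _)) => [/andP[/eqP-> /eqP yd]|ne].
  by rewrite mul1r; have [] := gamma_D dD (x := y); rewrite -?yd ?eqL_dL.
rewrite mul0r; apply: contraNeq ne => g.
rewrite (P2 H_P dD g) eqxx /=.
have [_ yd _] := P8 H_P g; rewrite DsetV // in yd.
by rewrite (left_cell_D dD yd).1.
Qed.

(** The coefficient of v'^a(y) in P15 with w = d. The monotonicity of the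
    a-function leaves on the left only the terms gamma_{d,x',z^-1} h_{x,z,y}. By
    P7 the gamma is gamma_{x',z^-1,d}, which is n_d if z = x' and d = d_{x'^-1},
    and zero otherwise. *)
Lemma hcoef_D_gamma x x' y d : d \in D -> a d = a y ->
  \sum_z hc x d z * (gam z x' y^-1%g)%:~R =
    ((dL x'^-1%g == d) && (a x' == a y))%:R * (nc d)%:~R * hc x x' y.
Proof.
move=> dD ady.
(* On the left, h_{x,z,y} <> 0 gives a(z) <= a(y), so that the coefficient of
   v'^a(y) in h'_{d,x',z} is a gamma if a(z) = a(y), and is zero otherwise. *)
have e := congr1 (coefv' (a y)%:Z) (P15 H_P x x' ady).
rewrite [LHS]coefv'_sum [RHS]coefv'_sum in e.
have e1 := eq_bigr _ (fun z _ => coefv'_in_v'M (hc d x' z) (hc x z y) (a y)%:Z).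
have e2 := eq_bigr _ (fun z _ => coefv'M_in_v' (hc z x' y) (hc x d z) (a y)%:Z).
have {e e1 e2} e := etrans (esym (e1 _ _ _ _)) (etrans e (e2 _ _ _ _)).
under eq_bigr do rewrite gammaE.
rewrite -e; rewrite (bigD1 x') //= big1 ?addr0 => [|z zx'].
  have [ax|ax] := eqVneq (a x') (a y); last first.
    rewrite andbF !mul0r.
    have [h0|/(hcoef_leL W_cox L_pos)/leL_leLR/a_leLR ayx] := eqVneq (hc x x' y) 0.
      by rewrite h0 mulr0.
    have /in_vZP -> := hcoef_in_vZ d x' x'; first by rewrite mul0r.
    by rewrite ltz_nat ltn_neqAle ax.
  rewrite andbT -ax -gammaE (P7 H_P) gamma_DE // invgK eqxx /=.
  by rewrite rmorphM /= rmorph_nat.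
have [-> |/(hcoef_leL W_cox L_pos)/leL_leLR/a_leLR ayz] := eqVneq (hc x z y) 0.
  by rewrite mulr0.
have [az|az] := eqVneq (a z) (a y); last first.
  have /in_vZP -> := hcoef_in_vZ d x' z; first by rewrite mul0r.
  by rewrite ltz_nat ltn_neqAle az.
by rewrite -az -gammaE (P7 H_P) gamma_DE // invgK eq_sym (negPf zx') !mul0r.
Qed.

Lemma gamma_neq0_a x y z : gam x y z^-1%g != 0 -> a y = a z /\ dL x = dL y^-1%g.
Proof.
case/(P8 H_P) => /eqL_trans xy; rewrite invgK => /a_eqL yz _; split=> //.
exact: (left_cell_D (dL_D _) (xy _ (eqL_dL _))).1.
Qed.

Section PhiHom.
Variables (J : asymptotic H Zv) (phi : {lrmorphism H -> J}).
Hypothesis phiP : is_phi phi.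
Local Notation t_ := (tbasis J).

Lemma phi_C x :
  phi (dg (C x)) = \sum_z (hc x (dL z) z * (nc (dL z))%:~R) *: t_ z.
Proof.
rewrite phiP [RHS](partition_big dL (mem D)) /=; last by move=> z _; apply: dL_D.
by apply: eq_bigr => d _; apply: eq_bigr => z /eqP->.
Qed.

(** With t_u in the role of the class of c_u^dag, J carries through phi the
    module structure of the associated graded of the Hecke algebra for the
    filtration by the a-function. *)
Lemma phi_C_mul x u :
  phi (dg (C x)) * t_ u = \sum_(y | a y == a u) hc x u y *: t_ y.
Proof.
apply: (bcoord_inj (b := t_)) => y.
rewrite phi_C mulr_suml bcoord_sum.
under eq_bigr do rewrite -scalerAl bcoordZ tbasis_mul bcoordE.
rewrite [RHS](_ : _ = (a y == a u)%:R * hc x u y); last first.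
  rewrite bcoord_sum big_mkcond (bigD1 y) //= big1 ?addr0 => [|z zy].
    by case: (a y == a u); rewrite ?mul0r // bcoordZ bcoord_bvec eqxx mulr1 mul1r.
  by case: (a z == a u) => //; rewrite bcoordZ bcoord_bvec eq_sym (negPf zy) mulr0.
have [ayu|ayu] := eqVneq (a y) (a u); last first.
  rewrite mul0r big1 // => z _.
  have [->|/gamma_neq0_a[auy _]] := eqVneq (gam z u y^-1%g) 0; first by rewrite mulr0.
  by rewrite auy eqxx in ayu.
(* If gamma_{z,u,y^-1} is nonzero then z and u^-1 are in the same left cell, so
   a single d contributes. *)
set d := dL u^-1%g; have dD : d \in D by apply: dL_D.
rewrite mul1r (eq_bigr (fun z => (nc d)%:~R * (hc x d z * (gam z u y^-1%g)%:~R))).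
  rewrite -mulr_sumr hcoef_D_gamma //; last by rewrite -(a_eqL (eqL_dL _)) a_inv ayu.
  by rewrite eqxx ayu eqxx mul1r mulrA -rmorphM ncoef_sqr // mul1r.
move=> z _; have [->|/gamma_neq0_a[_ ->]] := eqVneq (gam z u y^-1%g) 0.
  by rewrite !mulr0.
by rewrite mulrA; congr (_ * _); rewrite mulrC.
Qed.

Lemma phi_dag_mul k u :
  phi (dg k) * t_ u = \sum_(y | a y == a u) bcoord C y (k * C u) *: t_ y.
Proof.
rewrite {1}(bvecE C k) !linear_sum /= mulr_suml.
have pZ f z : phi (dg (f *: C z)) = f *: phi (dg (C z)) by rewrite linearZ /= linearZ.
under [LHS]eq_bigr do rewrite pZ -scalerAl phi_C_mul scaler_sumr.
rewrite exchange_big /=; apply: eq_bigr => y _.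
rewrite {2}(bvecE C k) mulr_suml bcoord_sum scaler_suml; apply: eq_bigr => z _.
by rewrite -scalerAl bcoordZ scalerA.
Qed.

End PhiHom.

End Asymptotic.

(** * The action of the longest element *)

Section Main.
Variables (W : finGroupType) (S : {set W}) (L : W -> nat).
Hypothesis W_cox : coxeter_system S.
Hypothesis L_pos : forall s, s \in S -> (0 < L s)%N.
Variable H : hecke S L.
Hypothesis H_P : propertiesP H.
Variables (star : W -> W) (eps : W -> int).
Hypothesis star_epsP : star_eps H star eps.
Local Notation w0 := (longest S).
Local Notation T := (Tbasis H).
Local Notation C := (cbasis H).
Local Notation dg := (dag H).
Local Notation hc := (hcoef H).
Local Notation eqL := (eqL H).
Local Notation eqLR := (eqLR H).
Local Notation a := (afun H).
Local Notation D := (Dset H).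
Local Notation gam := (gamma H).
Local Notation nc := (ncoef H).
Local Notation dL := (dL H).
Implicit Types x y z w s t u d : W.

Lemma star_cell u : eqLR u (star u) /\ (eps u = 1 \/ eps u = -1).
Proof.
have cW : [set z in [set: W] | eqLR u z] \in twosided_cells H.
  by apply: imset_f; rewrite inE.
have [_ cs ce _] := star_epsP cW.
have uc : u \in [set z in [set: W] | eqLR u z] by rewrite !inE eqLR_refl.
split; last exact: ce.
have : star u \in [set z in [set: W] | eqLR u z] by rewrite -cs imset_f.
by rewrite !inE.
Qed.

(** The element k is T_{w0} with the dagger removed. The error term in the
    definition of u* involves only y with a(y) > a(u), by P11. *)
Lemma star_coord k u y : dg k = T w0 -> a y = a u ->
  'v^((a u)%:Z - (a (w0 * u)%g)%:Z) * bcoord C y (k * C u) =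
    (eps u)%:~R * (y == star u)%:R.
Proof.
move=> kE ayu; have [dgi dgK dgiK] := dag_bij H.
have cW : [set z in [set: W] | eqLR u z] \in twosided_cells H.
  by apply: imset_f; rewrite inE.
have uc : u \in [set z in [set: W] | eqLR u z] by rewrite !inE eqLR_refl.
have [_ _ _ /(_ u uc)[f]] := star_epsP cW.
rewrite -kE -rmorphM /=.
move=> e.
have {}e : 'v^((a u)%:Z - (a (w0 * u)%g)%:Z) *: (k * C u) =
   \sum_(x | [exists x' in [set z in [set: W] | eqLR u z], ltLR H x x']) f x *: C x +
   (eps u)%:~R *: C (star u).
  apply: (can_inj dgK); rewrite linearD !linearZ linear_sum /=.
  under eq_bigr do rewrite linearZ.
  by move/eqP: e; rewrite subr_eq => /eqP.
move/(congr1 (bcoord C y)): e; rewrite bcoordZ bcoordD bcoord_sum bcoordZ bcoord_bvec => ->.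
rewrite big1 ?add0r // => x /existsP[x' /andP[]]; rewrite !inE /= => ux' /andP[xx' nxx'].
rewrite bcoordZ bcoord_bvec; case: eqP => [yx|]; last by rewrite mulr0.
case/negP: nxx'; apply: (P11 H_P xx').
by rewrite -yx ayu; apply: (a_eqLR H_P).
Qed.

Lemma bar_Tw0_C k u : dg k = T w0 ->
  hbar H (k * C u) = (-1) ^+ len S w0 *:
    \sum_z ((-1) ^+ len S (z^-1 * w0)%g * pcoef H 1%g (z^-1 * w0)%g) *: (C z * C u).
Proof.
move=> kE; have [dgi dgK _] := dag_bij H; apply: (can_inj dgK).
rewrite -bar_dag // !rmorphM /= kE bar_dag_C // (bar_Tw0_expand W_cox L_pos).
rewrite linearZ /= -scalerAl linear_sum mulr_suml /=; congr (_ *: _).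
by apply: eq_bigr => z _; rewrite linearZ /= rmorphM -scalerAl.
Qed.

(** The inverse of T_{w0} is the bar conjugate of T_{w0}, and it is up to sign
    the sum of the +-p_{1,z^-1 w0} c_z^dag. Comparing its action on c_d^dag with
    the bar conjugate of the action of T_{w0} gives, with a' = a(w0 d),
    +-eps_d v^(a(d) - a') = sum over z of +-p_{1,z^-1 w0} h_{z,d,d*}.
    In each nonzero term the first factor has degree at most -a', by P1 and
    because w0 reverses the preorders, and the second has degree at most a(d).
    Hence some z has nonzero coefficients at both bounds. The second factor
    gives gamma_{z,d,d*^-1} <> 0, so z = d* by P7 and P2, and d* is in the left
    cell of d by P8. The first gives Delta(d*^-1 w0) <= a(d*^-1 w0), so d*^-1 w0
    is in D, and by P6 it equals its inverse w0 d*. *)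
Lemma star_D d : d \in D -> eqL (star d) d /\ (w0 * star d)%g \in D.
Proof.
move=> dD; have [k' _ dgK'] := dag_bij H; pose k := k' (T w0).
have kE : dg k = T w0 by rewrite /k dgK'.
have [dds deps] := star_cell d.
have ads := a_eqLR H_P dds.
have adw : a ((star d)^-1 * w0)%g = a (w0 * d)%g.
  have e : eqLR (star d)^-1%g d^-1%g.
    rewrite eqLR_sym (eqLR_trans (y := d)) //; first by rewrite eqLR_sym (P14 H_P).
    by rewrite (eqLR_trans dds) // (P14 H_P).
  rewrite (a_eqLR H_P (eqLR_mul_w0 W_cox L_pos e)) -(a_inv H_P (w0 * d)%g).
  by rewrite invMg (longestV W_cox L_pos H).
set m := bcoord C (star d) (k * C d).
have mE : m@_((a (w0 * d)%g)%:Z - (a d)%:Z) = eps d.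
  have := star_coord kE (esym ads); rewrite -/m eqxx mulr1 mulrC.
  move/(congr1 (mcoeff 0)); rewrite mcoeffM_vpow mcoeff_intr intz eqxx mulr1n => <-.
  by rewrite sub0r opprB.
have vmE : (vbar m)@_((a d)%:Z - (a (w0 * d)%g)%:Z) != 0.
  by rewrite mcoeff_vbar opprB mE; case: deps => ->.
pose b z : Zv := (-1) ^+ len S (z^-1 * w0)%g * pcoef H 1%g (z^-1 * w0)%g.
have bE : vbar m = (-1) ^+ len S w0 * \sum_z b z * hc z d (star d).
  rewrite -bcoord_bar (bar_Tw0_C _ kE) bcoordZ bcoord_sum; congr (_ * _).
  by apply: eq_bigr => z _; rewrite bcoordZ.
have {vmE bE} [z] : exists z,
    (b z * hc z d (star d))@_(- (a (w0 * d)%g)%:Z + (a (star d))%:Z) != 0.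
  apply: sum_neq0_ex; move: vmE; rewrite bE mcoeff_sign mcoeff_sum -ads addrC.
  by apply: contraNneq => ->; rewrite mulr0.
have [->|hz] := eqVneq (hc z d (star d)) 0; first by rewrite mulr0 mcoeff0 eqxx.
have az : (a (w0 * d)%g <= a (z^-1 * w0)%g)%N.
  rewrite -adw; apply/(a_leLR H_P)/leL_leLR/(leL_mul_w0 W_cox L_pos).
  exact: hcoef_leR hz.
have bz : in_vZ (- (a (w0 * d)%g)%:Z) (b z).
  rewrite in_vZ_sign //; apply: in_vZ_trans (in_vZ_topdeg _).
  have := P1 H_P (z^-1 * w0)%g; rewrite /Delta; lia.
rewrite (mcoeffM_top bz (hcoef_in_vZ _ _ _ _)) mulf_eq0 negb_or -gammaE => /andP[bz0 g].
have zd : z = star d.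
  by move: g; rewrite (P7 H_P) (P7 H_P) => /(P2 H_P dD)/invg_inj.
have [_ sd _] := P8 H_P g; rewrite invgK eqL_sym in sd.
rewrite {}zd in bz0 *; split=> //.
have sw0D : ((star d)^-1 * w0)%g \in D.
  rewrite inE; apply/eqP/le_anti; rewrite (P1 H_P) /= adw /Delta lerNl.
  by apply: le_topdeg; apply: contraNneq bz0; rewrite /b mcoeff_sign => ->; rewrite mulr0.
by have := sw0D; rewrite -(DsetV H_P sw0D) invMg invgK (longestV W_cox L_pos H).
Qed.

(** The element of D in the left cell of w0 d is w0 d*, so theta(d) is
    gamma_{d*,d,d*^-1}, a cyclic rotation of gamma_{d*^-1,d*,d} = n_d. *)
Lemma theta_D d : d \in D -> theta H star d = nc d.
Proof.
move=> dD; have [sd w0sD] := star_D dD.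
rewrite /theta (DsetV H_P dD).
have -> : dL (w0 * d)%g = (w0 * star d)%g.
  apply: (left_cell_D H_P w0sD _).1; rewrite eqL_sym.
  exact: eqL_w0_mul.
rewrite mulgA (longestK W_cox L_pos H) mul1g (P7 H_P) (P7 H_P).
exact: (gamma_D H_P dD sd).1.
Qed.

Lemma phi_Tw0_mul (J : asymptotic H Zv) (phi : {lrmorphism H -> J}) (phiP : is_phi phi) u :
  phi (T w0) * tbasis J u =
    ((eps u)%:~R * 'v^(- (a u)%:Z + (a (w0 * u)%g)%:Z)) *: tbasis J (star u).
Proof.
have [k' _ dgK'] := dag_bij H; have kE := dgK' (T w0).
have [uu _] := star_cell u.
rewrite -{1}kE (phi_dag_mul W_cox L_pos H_P phiP).
have co y : a y = a u -> bcoord (cbasis H) y (k' (T w0) * C u) =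
    'v^(- (a u)%:Z + (a (w0 * u)%g)%:Z) * ((eps u)%:~R * (y == star u)%:R).
  move=> ayu; rewrite -(star_coord kE ayu) mulrA -vpowD.
  by rewrite addrAC addKr addNr vpow0 mul1r.
rewrite (bigD1 (star u)) /= ?(a_eqLR H_P uu) // co ?(a_eqLR H_P uu) // eqxx mulr1 mulrC.
rewrite big1 ?addr0 // => y /andP[/eqP ayu /negPf yu].
by rewrite co ?yu ?mulr0 ?scale0r // ayu (a_eqLR H_P uu).
Qed.

End Main.

Theorem corollary2p8 (W : finGroupType) (S : {set W}) (L : W -> nat)
  (W_cox : coxeter_system S)
  (L_weight : weight_function S L)
  (L_pos : forall s, s \in S -> (0 < L s)%N)
  (H : hecke S L) (H_P : propertiesP H)
  (star : W -> W) (eps : W -> int) (star_epsP : star_eps H star eps)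
  (J : asymptotic H Zv) (phi : {lrmorphism H -> J}) (phiP : is_phi phi) :
  phi (Tbasis H (longest S)) =
    \sum_(d in Dset H)
      ((theta H star d)%:~R * (eps d)%:~R
         * 'v^(- (afun H d)%:Z + (afun H (longest S * d)%g)%:Z))
      *: tbasis J (star d).
Proof.
rewrite -[LHS]mulr1 tbasis_one mulr_sumr; apply: eq_bigr => d dD.
rewrite -scalerAr (phi_Tw0_mul W_cox L_pos H_P star_epsP phiP) scalerA.
by rewrite (theta_D W_cox L_pos H_P star_epsP dD) mulrA.
Qed.
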